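(* Let $0<\alpha<1$ and let $f$ be a real function on $[1,T]$ with $I^{1-\alpha}f\in C^1([1,T])$. (i) If $f$ attains its maximum value over $[1,T]$ at a point $t_0\in[1,T]$, then $$D^{\alpha}f(t_0)\ \ge\ \frac{1}{\Gamma(1-\alpha)}(\log t_0)^{-\alpha}f(t_0).$$ Moreover, if $f(t_0)\ge 0$, then $D^{\alpha}f(t_0)\ge 0$. (ii) If $f$ attains its minimum value over $[1,T]$ at a point $t_0\in[1,T]$, then $$D^{\alpha}f(t_0)\ \le\ \frac{1}{\Gamma(1-\alpha)}(\log t_0)^{-\alpha}f(t_0).$$ Moreover, if $f(t_0)\le 0$, then $D^{\alpha}f(t_0)\le 0$.
   Context: Here $T>1$. The Hadamard fractional integral of order $\beta>0$ with base point $1$ is $$I^{\beta}f(t)=\frac{1}{\Gamma(\beta)}\int_1^t\left(\log\frac{t}{s}\right)^{\beta-1}f(s)\,\frac{ds}{s},$$ and the Hadamard fractional derivative of order $\alpha\in(0,1)$ with base point $1$, defined for $f\in L^1([1,T])$ with $I^{1-\alpha}f$ in the Sobolev space $W^1_2([1,T])$, is $$D^{\alpha}f(t)=t\frac{d}{dt}I^{1-\alpha}f(t)=\frac{1}{\Gamma(1-\alpha)}\,t\frac{d}{dt}\int_1^t\left(\log\frac{t}{s}\right)^{-\alpha}f(s)\,\frac{ds}{s}.$$ $\Gamma$ is the Euler gamma function.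
   Formalization: The point t0 is taken in (1,T], as (log t0)^{-α} is undefined at t0=1 and the ''Moreover'' fails there for f=-(log t)^α; and f is assumed continuous at t0 relative to [1,T], since changing f at the single point t0 otherwise refutes the claim. *)

(* Defs.v *)
From HB Require Import structures.
From mathcomp Require Import all_boot all_order all_algebra.
From mathcomp Require Import all_classical all_reals all_analysis.

Set Implicit Arguments.
Unset Strict Implicit.
Unset Printing Implicit Defensive.

Import Order.TTheory GRing.Theory Num.Theory.
Import numFieldNormedType.Exports.

Local Open Scope classical_set_scope.
Local Open Scope ring_scope.

Definition Gamma (R : realType) (z : R) : R :=
  \int[lebesgue_measure]_(x in `]0, +oo[) (x `^ (z - 1) * expR (- x)).

(* The singular value at s = t is irrelevant: it is a single point. *)
Definition hadamard_int (R : realType) (beta : R) (f : R -> R) (t : R) : R :=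
  (Gamma beta)^-1 *
  \int[lebesgue_measure]_(s in `[1, t]) (ln (t / s) `^ (beta - 1) * f s / s).

(* Derivatives are taken relative to a set A, so that at an end point of
   A = `[a, b] they are one-sided and only the values of F on A matter. *)
Definition diff_quot (R : realType) (F : R -> R) (t s : R) : R :=
  (F s - F t) / (s - t).

Definition derivable_in (R : realType) (A : set R) (F : R -> R) (t : R) : Prop :=
  cvg (diff_quot F t @ within A t^').

Definition derive_in (R : realType) (A : set R) (F : R -> R) (t : R) : R :=
  lim (diff_quot F t @ within A t^').

Definition C1_in (R : realType) (A : set R) (F : R -> R) : Prop :=
  (forall t, A t -> derivable_in A F t) /\
  {within A, continuous (derive_in A F)}.

Definition hadamard_der (R : realType) (T alpha : R) (f : R -> R) (t : R) : R :=
  t * derive_in `[1, T] (hadamard_int (1 - alpha) f) t.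

(* Main.v *)
Require Import Defs.
From HB Require Import structures.
From mathcomp Require Import all_boot all_order all_algebra.
From mathcomp Require Import all_classical all_reals all_analysis.
From mathcomp Require Import measurable_realfun ring lra.
Import Order.TTheory GRing.Theory Num.Theory.
Import numFieldNormedType.Exports.
Local Open Scope classical_set_scope.
Local Open Scope ring_scope.

(** Let t0 be a maximum point, c0 = f t0 and g = c0 - f, so that g >= 0
    on [1, T] and g tends to g t0 = 0 at t0.  The Hadamard integral of a
    constant is explicit (integral_lnker), whence (hadamard_intE)

      Gamma (1 - alpha) I^(1 - alpha) f (t)
        = c0 (ln t)^(1 - alpha) / (1 - alpha) - G t,

    where G t is the integral of (ln (t / s))^(- alpha) g(s) / s over ]1, t[.  The
    assertion is that the derivative of G at t0 is at most 0.  Suppose it is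
    positive.  As I^(1 - alpha) f is C^1, there are a < t0 and c > 0 such that the
    difference quotients of G on ]a, t0[ are at least c.

    The contribution of ]1, a[ to G is nonincreasing for t > a.  So the remainder
    J, the analogue of G based at a, also has difference quotients at least c
    (lnconv_rebase).  Abel's inversion (integral_lnker_lnconv) says that

      P t := int_a^t (ln (t / s))^(alpha - 1) J(s) ds / s = B int_a^t g(v) dv / v

    for a finite constant B, a Beta integral (integral_lnker_lnker).  The right
    hand side has derivative B g(t0) / t0 = 0 at t0.  But when J increases with
    slope at least c, the left hand side has a lower derivative > 0 at t0
    (lnconv_growth_absurd).  This contradiction proves the inequality for a
    maximum, and the one for a minimum follows by passing to - f.

    One point needs care.  For an integrable f the integral defining
    I^(1 - alpha) f (t) can diverge for some t, and it is then replaced by 0.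
    Convolutions of nonnegative functions are therefore taken in the extended
    reals, and the argument uses only the points where they are finite; almost
    every point is one. *)

Set Implicit Arguments.
Unset Strict Implicit.

(** * Substitution on an open interval *)

Section substitution.
Context {R : realType}.
Notation mu := (@lebesgue_measure R).

(** Closed subintervals exhausting the open interval from a to b; the offset 3
    keeps even the first of them nondegenerate. *)
Let shrink (a b : R) (n : nat) : set R :=
  `[a + (b - a) / n.+3%:R, b - (b - a) / n.+3%:R].

Let shrink_sub (a b : R) n : a < b -> shrink a b n `<=` `]a, b[.
Proof.
move=> ab x; rewrite /shrink /= !in_itv /= => /andP[ax xb].
have : 0 < (b - a) / n.+3%:R by rewrite divr_gt0// subr_gt0.
by move: (_ / _) ax xb => d *; lra.
Qed.

Let shrink_mono (a b : R) : a < b -> nondecreasing_seq (shrink a b).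
Proof.
move=> ab m n mn; rewrite subsetEset /shrink => x /=; rewrite !in_itv /=.
have h : (b - a) / n.+3%:R <= (b - a) / m.+3%:R.
  by rewrite ler_pM2l ?subr_gt0// lef_pV2 ?posrE// ler_nat.
move: (_ / _) (_ / _) h => d e h /andP[ax xb]; lra.
Qed.

Let shrink_ex (a b x : R) : a < x < b -> exists n, shrink a b n x.
Proof.
move=> /andP[ax xb].
pose d : R := Num.min (x - a) (b - x).
have d0 : 0 < d by rewrite lt_min !subr_gt0 ax xb.
have [n hn] : exists n, (b - a) / d <= n.+3%:R.
  exists (Num.truncn ((b - a) / d)).
  by rewrite (le_trans (ltW (truncnS_gt _)))// ler_nat ltnS !leqW.
have ab : 0 < b - a by lra.
have h : (b - a) / n.+3%:R <= d.
  by rewrite ler_pdivrMr// mulrC -ler_pdivrMr.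
exists n; rewrite /shrink /= in_itv /=.
by move: h; rewrite le_min; move: (_ / _) => e /andP[h1 h2]; lra.
Qed.

(** The substitution rule for continuous integrands on a compact interval,
    applied on intervals that exhaust the open interval, passes to the limit by
    monotone convergence.  So the integrand may blow up at the end points, and
    the two sides may be infinite.  All the kernels below are of this kind. *)
Lemma ge0_substitution_oo (F f G : R -> R) (a b : R) : a < b ->
  {within `[a, b], continuous F} ->
  {in `]a, b[, forall x : R, is_derive x 1 F (f x)} ->
  {in `]a, b[, continuous f} ->
  {in `]a, b[, forall x, 0 < f x} ->
  {in `]F a, F b[, continuous G} ->
  {in `]F a, F b[, forall y, 0 <= G y} ->
  (\int[mu]_(y in `]F a, F b[) (G y)%:E =
   \int[mu]_(x in `]a, b[) (G (F x) * f x)%:E)%E.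
Proof.
move=> ab cF dF cf f0 cG G0.
have dF1 : {in `]a, b[, forall x, derivable F x 1}.
  by move=> x /dF h; exact: ex_derive.
have dFE : {in `]a, b[, derive1 F =1 f}.
  by move=> x /dF h; rewrite derive1E derive_val.
have incF : {in `[a, b] &, {homo F : x y / x < y}}.
  have dF0 x : x \in `]a, b[ -> 0 < derive1 F x by move=> xab; rewrite dFE ?f0.
  exact: (gtr0_derive1_lt dF1 dF0 cF).
have Fxab x : x \in `]a, b[ -> F x \in `]F a, F b[.
  rewrite !in_itv /= => /andP[ax xb].
  by rewrite !incF// in_itv/= ?lexx ?ltW// (lt_trans ax xb).
pose u n : R := a + (b - a) / n.+3%:R.
pose v n : R := b - (b - a) / n.+3%:R.
have shrinkuv n : shrink a b n = `[u n, v n]%classic by [].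
have xyn n : [/\ a < u n, u n < v n & v n < b].
  have h : 0 < (b - a) / n.+3%:R by rewrite divr_gt0// subr_gt0.
  have h3 : (b - a) / n.+3%:R * 3 <= (b - a).
    rewrite mulrAC ler_pdivrMr// ler_wpM2l ?subr_ge0 ?(ltW ab)//.
    by rewrite (ler_nat R 3).
  by rewrite /u /v; move: (_ / _) h h3 => d *; split; lra.
move: u v shrinkuv xyn => u v shrinkuv xyn.
pose K n : set R := `[F (u n), F (v n)]%classic.
have Kim n : K n `<=` F @` shrink a b n.
  move=> y; rewrite /K /= in_itv /= => yK; have [h1 h2 h3] := xyn n.
  have [] := @IVT _ F _ _ y (ltW h2) _ _.
  - apply: continuous_subspaceW cF => x /=; rewrite !in_itv/= => /andP[].
    by move=> *; apply/andP; split; lra.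
  - have /andP[k1 k2] := yK.
    by rewrite ge_min k1 /= le_max k2 orbT.
  by move=> x xx <-; exists x; rewrite ?shrinkuv.
have Ksub n : F @` shrink a b n `<=` K n.
  move=> _ [x + <-]; rewrite shrinkuv /K /= !in_itv /= => /andP[x1 x2].
  have [h1 h2 h3] := xyn n.
  have hom : {in `[a, b] &, {homo F : x y / x <= y}}.
    by apply: ltW_homo_in.
  by rewrite !hom// in_itv/=; apply/andP; split; lra.
have KE n : K n = F @` shrink a b n by apply/seteqP; split.
have shrinkE : \bigcup_n shrink a b n = `]a, b[%classic.
  apply/seteqP; split => x.
    by move=> [n _]; exact: shrink_sub.
  by rewrite /= in_itv/= => /shrink_ex[n]; exists n.
have KUE : \bigcup_n K n = `]F a, F b[%classic.
  apply/seteqP; split => y.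
    move=> [n _]; rewrite KE => -[x /(shrink_sub ab) xab <-]; exact: Fxab.
  move=> /= yab; have [] := @IVT _ F _ _ y (ltW ab) cF.
    move: yab; rewrite in_itv/= => /andP[/ltW ya /ltW yb].
    by rewrite ge_min le_max ya yb orbT.
  move=> x xab Fx; have xab' : a < x < b.
    move: xab yab; rewrite !in_itv/= -Fx => /andP[].
    rewrite le_eqVlt => /orP[/eqP<-|->]; first by rewrite ltxx.
    by rewrite le_eqVlt => /orP[/eqP->|->//]; rewrite ltxx andbF.
  have [n xn] := shrink_ex xab'.
  by exists n => //; rewrite KE; exists x.
have mf : measurable_fun `]a, b[ f.
  by apply: open_continuous_measurable_fun => // x; rewrite inE; exact: cf.
have mG : measurable_fun `]F a, F b[ G.
  by apply: open_continuous_measurable_fun => // x; rewrite inE; exact: cG.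
have cFo : {in `]a, b[, continuous F}.
  move=> x /dF1 h; exact/differentiable_continuous/derivable1_diffP.
have mGF : measurable_fun `]a, b[ (fun x => G (F x) * f x).
  apply: measurable_funM => //.
  apply: open_continuous_measurable_fun => // x; rewrite inE => xab.
  by apply: continuous_comp; [exact: cFo|exact/cG/Fxab].
have lim1 : (\int[mu]_(x in shrink a b n) (G (F x) * f x)%:E @[n --> \oo] -->
    \int[mu]_(x in `]a, b[) (G (F x) * f x)%:E)%E.
  rewrite -shrinkE; apply: ge0_nondecreasing_set_cvg_integral.
  - exact: shrink_mono.
  - by move=> n; exact: measurable_itv.
  - move=> n; apply/measurable_EFinP; apply: measurable_funS mGF => //.
    exact: shrink_sub.
  - move=> n x /(shrink_sub ab) xab.
    by rewrite lee_fin mulr_ge0 ?G0 ?Fxab// ltW// f0.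
have lim2 : (\int[mu]_(y in K n) (G y)%:E @[n --> \oo] -->
    \int[mu]_(y in `]F a, F b[) (G y)%:E)%E.
  have KFab n : K n `<=` `]F a, F b[.
    by rewrite -KUE; exact: bigcup_sup.
  rewrite -KUE; apply: ge0_nondecreasing_set_cvg_integral.
  - move=> m n mn; have := shrink_mono ab mn; rewrite !subsetEset !KE.
    exact: image_subset.
  - by move=> n; exact: measurable_itv.
  - by move=> n; apply/measurable_EFinP; exact: measurable_funS mG.
  - by move=> n x /KFab xab; rewrite lee_fin G0.
have eqn n : (\int[mu]_(y in K n) (G y)%:E =
    \int[mu]_(x in shrink a b n) (G (F x) * f x)%:E)%E.
  have [h1 h2 h3] := xyn n.
  have sub : `[u n, v n] `<=` `]a, b[.
    by move=> x xn; apply: (@shrink_sub a b n) => //; rewrite shrinkuv.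
  have subo x : x \in `](u n), (v n)[ ->
      x \in `]a, b[.
    by move=> xi; apply: sub; apply: subset_itv_oo_cc xi.
  have e1 : u n \in `]a, b[ by rewrite in_itv/=; lra.
  have e2 : v n \in `]a, b[ by rewrite in_itv/=; lra.
  have cF' : {in `]a, b[, continuous (derive1 F)}.
    move=> x xab; rewrite /continuous_at dFE//.
    apply: cvg_trans (cf _ xab); apply: near_eq_cvg.
    by near=> z; rewrite dFE//; near: z; exact: near_in_itvoo.
  rewrite shrinkuv /K (@integration_by_substitution_increasing R F G (u n) (v n)).
  - apply: eq_integral => x; rewrite inE => xn.
    by rewrite /= !fctE dFE//; exact: sub.
  - exact: ltW.
  - move=> x y xI yI; apply: incF; apply: subset_itv_oo_cc; exact: sub.
  - by move=> x /subo; exact: cF'.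
  - apply/cvg_ex; exists (derive1 F (u n)).
    exact/cvg_at_right_filter/cF'.
  - apply/cvg_ex; exists (derive1 F (v n)).
    exact/cvg_at_left_filter/cF'.
  - split.
    + by move=> x /subo; exact: dF1.
    + exact/cvg_at_right_filter/cFo.
    + exact/cvg_at_left_filter/cFo.
  - apply: continuous_in_subspaceT => y; rewrite inE => yK.
    apply: cG; have : (\bigcup_n K n) y by exists n.
    by rewrite KUE.
apply: cvg_unique lim2 _ => //.
by apply: cvg_trans lim1; apply: near_eq_cvg; near=> n; rewrite eqn.
Unshelve. all: by end_near. Qed.

(** Substituting F in the integral of the constant 1 over ]F a, F b[ turns it
    into the integral of F' = f, which may be unbounded near a and b. *)
Lemma gt0_FTC2_oo (F f : R -> R) (a b : R) : a < b ->
  {within `[a, b], continuous F} ->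
  {in `]a, b[, forall x : R, is_derive x 1 F (f x)} ->
  {in `]a, b[, continuous f} ->
  {in `]a, b[, forall x, 0 < f x} ->
  (\int[mu]_(x in `]a, b[) (f x)%:E = (F b - F a)%:E)%E.
Proof.
move=> ab cF dF cf f0.
have Fab : F a < F b.
  have dF1 : {in `]a, b[, forall x : R, derivable F x 1}.
    by move=> x /dF h; exact: ex_derive.
  have dF0 x : x \in `]a, b[ -> 0 < derive1 F x.
    by move=> xab; rewrite derive1E; have h := dF _ xab; rewrite derive_val f0.
  by apply: (gtr0_derive1_lt dF1 dF0 cF); rewrite // in_itv/= lexx ltW.
transitivity (\int[mu]_(x in `]a, b[) (cst 1 (F x) * f x)%:E)%E.
  by apply: eq_integral => x _; rewrite /= mul1r.
rewrite -(@ge0_substitution_oo F f (cst 1))//.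
  by rewrite (integral_cst _ _ 1%E)//= lebesgue_measure_itv/= lte_fin Fab mul1e EFinB.
by move=> y _; exact: cst_continuous.
Qed.

End substitution.

(** * The logarithmic kernel *)

Section kernel.
Context {R : realType}.
Notation mu := (@lebesgue_measure R).

(** The Hadamard integral of order b integrates f against this kernel, up to the
    factor 1 / Gamma b.  In the variable ln s it is the convolution kernel
    x `^ (b - 1). *)
Definition lnker (b t s : R) : R := ln (t / s) `^ (b - 1) / s.

(** A negative number has power 1, so x |-> x `^ b is continuous at 0 from the
    right only; hence the sign condition on u. *)
Lemma cvg_powR0 {T : Type} (F : set_system T) {FF : Filter F} (u : T -> R) (b : R) :
  0 < b -> (\forall x \near F, 0 <= u x) -> u x @[x --> F] --> (0 : R) ->
  u x `^ b @[x --> F] --> (0 : R).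
Proof.
move=> b0 u0 cu; apply/cvgrPdist_lt => e e0.
have e1 : 0 < e `^ b^-1 by rewrite powR_gt0.
near=> x; rewrite sub0r normrN ger0_norm ?powR_ge0//.
have ux0 : 0 <= u x by near: x.
have -> : e = (e `^ b^-1) `^ b by rewrite -powRrM mulVf ?gt_eqF// powRr1// ltW.
apply: gt0_ltr_powR; rewrite ?nnegrE ?powR_ge0//.
rewrite -[u x]ger0_norm//; near: x.
have /cvgrPdist_lt /(_ _ e1) := cu; apply: filterS => x.
by rewrite sub0r normrN.
Unshelve. all: by end_near. Qed.

Lemma is_derive_ln_divl (t s : R) : 0 < t -> 0 < s ->
  is_derive t (1 : R) (fun t : R => ln (t / s)) t^-1.
Proof.
move=> t0 s0; apply: (@near_eq_is_derive _ _ _ (fun x => ln x - ln s)).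
  by near=> z; rewrite ln_div// posrE; near: z; exact: lt_nbhsr.
have h := is_derive1_ln t0.
have -> : t^-1 = t^-1 - 0 by rewrite subr0.
exact: is_deriveB.
Unshelve. all: by end_near. Qed.

Lemma is_derive_ln_div (t s : R) : 0 < t -> 0 < s ->
  is_derive s (1 : R) (fun s : R => ln (t / s)) (- s^-1).
Proof.
move=> t0 s0.
apply: (@near_eq_is_derive _ _ _ (fun x => ln t - ln x)).
  by near=> z; rewrite ln_div// posrE; near: z; exact: lt_nbhsr.
have h := is_derive1_ln s0.
have -> : - s^-1 = 0 - s^-1 by rewrite sub0r.
exact: is_deriveB.
Unshelve. all: by end_near. Qed.

Lemma ln_div_gt0 (t s : R) : 0 < s < t -> 0 < ln (t / s).
Proof. by move=> /andP[s0 st]; rewrite ln_gt0// ltr_pdivlMr// mul1r. Qed.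

Lemma is_derive_powR_ln_div (b t s : R) : 0 < s < t ->
  is_derive s (1 : R) (fun s : R => ln (t / s) `^ b) (- (b * lnker b t s)).
Proof.
move=> st; have /andP[s0 st'] := st; have t0 := lt_trans s0 st'.
have h1 := is_derive_ln_div t0 s0.
have h2 := is_derive1_powR b (ln_div_gt0 st).
have := @is_derive1_comp R (fun x => x `^ b) (fun s => ln (t / s)) _ _ _ h2 h1.
by rewrite mulrN /lnker mulrA.
Qed.

Lemma lnker_ge0 (b t s : R) : 0 <= s -> 0 <= lnker b t s.
Proof. by move=> s0; rewrite divr_ge0 ?powR_ge0. Qed.

Lemma lnker_gt0 (b t s : R) : 0 < s < t -> 0 < lnker b t s.
Proof.
by move=> st; rewrite divr_gt0 ?powR_gt0 ?ln_div_gt0//; case/andP: st.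
Qed.

Lemma continuous_powR_ln_div (b t s : R) : 0 < s < t ->
  {for s, continuous (fun s : R => ln (t / s) `^ b)}.
Proof.
move=> st; apply/differentiable_continuous/derivable1_diffP.
by have h := is_derive_powR_ln_div b st; exact: ex_derive.
Qed.

Lemma continuous_lnker (b t s : R) : 0 < s < t -> {for s, continuous (lnker b t)}.
Proof.
move=> st; apply: cvgM; first exact: continuous_powR_ln_div.
by apply: cvgV => //; case/andP: st => s0 _; rewrite gt_eqF.
Qed.

Lemma within_continuous_powR_ln_div (b x t : R) : 0 < b -> 0 < x < t ->
  {within `[x, t], continuous (fun s : R => ln (t / s) `^ b)}.
Proof.
move=> b0 /andP[x0 xt]; have t0 := lt_trans x0 xt.
apply/(continuous_within_itvP _ xt); split.
- move=> s; rewrite in_itv/= => /andP[xs st].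
  by apply: continuous_powR_ln_div; rewrite st (lt_trans x0).
- by apply/cvg_at_right_filter/continuous_powR_ln_div; rewrite x0.
- rewrite divff ?gt_eqF// ln1 powR0 ?gt_eqF//; apply: cvg_powR0 => //.
    near=> s; apply/ltW/ln_div_gt0; apply/andP; split=> //.
  have : ln (t / s) @[s --> t^'-] --> ln (t / t).
    apply: cvg_at_left_filter.
    suff : {for t, continuous (fun s : R => ln (t / s))} by [].
    apply/differentiable_continuous/derivable1_diffP.
    by have h := is_derive_ln_div t0 t0; exact: ex_derive.
  by rewrite divff ?gt_eqF// ln1.
Unshelve. all: by end_near. Qed.

(** - ln (t / s) `^ b / b is an antiderivative of the kernel in s. *)
Lemma integral_lnker (b x t : R) : 0 < b -> 0 < x < t ->
  (\int[mu]_(s in `]x, t[) (lnker b t s)%:E = (ln (t / x) `^ b / b)%:E)%E.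
Proof.
move=> b0 xt; have /andP[x0 xt'] := xt.
pose F s : R := - b^-1 * ln (t / s) `^ b.
rewrite (@gt0_FTC2_oo _ F)//; first last.
- by move=> s; rewrite in_itv/= => /andP[xs st]; rewrite lnker_gt0// st (lt_trans x0).
- move=> s; rewrite in_itv/= => /andP[xs st].
  by apply: continuous_lnker; rewrite st (lt_trans x0).
- move=> s; rewrite in_itv/= => /andP[xs st].
  have st0 : 0 < s < t by rewrite st (lt_trans x0).
  have h := is_derive_powR_ln_div b st0.
  have -> : lnker b t s = - b^-1 *: (- (b * lnker b t s)).
    by rewrite /GRing.scale /= mulrNN mulKf ?gt_eqF.
  exact: is_deriveZ.
- move=> s; apply: cvgM; first exact: cvg_cst.
  exact: within_continuous_powR_ln_div.
have t0 : 0 < t by exact: lt_trans xt'.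
by rewrite /F divff ?gt_eqF// ln1 powR0 ?gt_eqF// mulr0 mulNr sub0r opprK mulrC.
Qed.

Lemma lnker_nincr (b s t t' : R) : b <= 1 -> 0 < s < t -> t < t' ->
  lnker b t' s <= lnker b t s.
Proof.
move=> b1 st tt'; have /andP[s0 st'] := st; have t0 := lt_trans s0 st'.
have l : 0 < ln (t / s) by exact: ln_div_gt0.
have l' : 0 < ln (t' / s) by rewrite ln_div_gt0// s0 (lt_trans st').
rewrite ler_wpM2r ?invr_ge0 ?(ltW s0)// -opprB !powRN lef_pV2 ?posrE ?powR_gt0//.
apply: ge0_ler_powR; rewrite ?nnegrE ?subr_ge0 ?(ltW l) ?(ltW l')//.
rewrite ler_ln ?posrE ?divr_gt0// ?(lt_trans t0)//.
by rewrite ler_wpM2r ?invr_ge0 ?(ltW s0) ?(ltW tt').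
Qed.

(** The mean value theorem for t |-> ln (t / s) `^ (al - 1), whose derivative is
    of constant sign and bounded away from 0 for s < t < t0 and s > a. *)
Lemma lnkerB_lb (al a s t1 t0 : R) : 0 < al < 1 -> 0 < a < s -> s < t1 < t0 ->
  (1 - al) * ln (t0 / a) `^ (al - 2) / t0 / t0 * (t0 - t1) <=
  lnker al t1 s - lnker al t0 s.
Proof.
move=> /andP[al0 al1] /andP[a0 as_] /andP[st1 t10].
have s0 := lt_trans a0 as_; have t0s := lt_trans st1 t10.
have t00 := lt_trans s0 t0s.
pose phi t : R := ln (t / s) `^ (al - 1).
pose dphi t : R := (al - 1) * ln (t / s) `^ (al - 2) * t^-1.
have dE t : s < t -> is_derive t (1 : R) phi (dphi t).
  move=> st; have t0_ := lt_trans s0 st.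
  have st' : 0 < s < t by rewrite s0.
  have h1 := is_derive_ln_divl t0_ s0.
  have h2 := is_derive1_powR (al - 1) (ln_div_gt0 st').
  have := @is_derive1_comp R (fun x => x `^ (al - 1)) (fun t => ln (t / s)) _ _ _ h2 h1.
  by rewrite (_ : al - 1 - 1 = al - 2)//; ring.
have [||xi] := @MVT R phi dphi t1 t0 t10.
- by move=> x; rewrite in_itv/= => /andP[t1x _]; apply: dE; exact: lt_trans t1x.
- apply: derivable_within_continuous => x; rewrite in_itv/= => /andP[t1x _].
  by have h := dE _ (lt_le_trans st1 t1x); exact: ex_derive.
rewrite in_itv/= => /andP[t1xi xit0] E.
have sxi := lt_trans st1 t1xi; have xi0 := lt_trans s0 sxi.
have -> : lnker al t1 s - lnker al t0 s = - dphi xi * s^-1 * (t0 - t1).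
  by rewrite /lnker -mulrBl -/(phi t1) -/(phi t0) -opprB E; ring.
rewrite ler_wpM2r//; first by rewrite subr_ge0 ltW.
rewrite /dphi -!mulNr opprB.
have l0 : 0 < ln (xi / s) by rewrite ln_div_gt0// s0.
apply: ler_pM; rewrite ?mulr_ge0 ?powR_ge0 ?invr_ge0 ?(ltW t00) ?subr_ge0 ?(ltW al1)//.
- apply: ler_pM; rewrite ?mulr_ge0 ?powR_ge0 ?invr_ge0 ?(ltW t00) ?subr_ge0 ?(ltW al1)//.
  + rewrite ler_wpM2l ?subr_ge0 ?(ltW al1)//.
    rewrite -opprB !powRN lef_pV2 ?posrE ?powR_gt0//; last first.
      by rewrite ln_div_gt0// a0 (lt_trans as_).
    apply: ge0_ler_powR; rewrite ?nnegrE ?(ltW l0)//; first by lra.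
      by rewrite ltW// ln_div_gt0// a0 (lt_trans as_).
    rewrite ler_ln ?posrE ?divr_gt0//.
    apply: ler_pM; rewrite ?invr_ge0 ?(ltW xi0) ?(ltW s0) ?(ltW xit0)//.
    by rewrite lef_pV2 ?posrE// ltW.
  + by rewrite lef_pV2 ?posrE// ltW.
- by rewrite lef_pV2 ?posrE// ltW.
Qed.

End kernel.

(** * Composition of two kernels and the Beta integral *)

Section beta.
Context {R : realType}.
Notation mu := (@lebesgue_measure R).

Let beta_density (al x : R) : R := x `^ (- al) * (1 - x) `^ (al - 1).

Lemma continuous_powR_gt0 (r x : R) : 0 < x -> {for x, continuous (fun x : R => x `^ r)}.
Proof.
move=> x0; apply/differentiable_continuous/derivable1_diffP.
by have h := is_derive1_powR r x0; exact: ex_derive.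
Qed.

Lemma integral_powR_01 (b : R) : 0 < b ->
  (\int[mu]_(x in `]0%R, 1%R[) (x `^ (b - 1))%:E = (b^-1)%:E)%E.
Proof.
move=> b0; rewrite (@gt0_FTC2_oo _ (fun x => b^-1 * x `^ b))//; first last.
- by move=> s; rewrite in_itv/= => /andP[s0 _]; rewrite powR_gt0.
- by move=> x; rewrite in_itv/= => /andP[x0 _]; exact: continuous_powR_gt0.
- move=> x; rewrite in_itv/= => /andP[x0 _].
  have h := is_derive1_powR b x0.
  have -> : x `^ (b - 1) = b^-1 *: (b * x `^ (b - 1)).
    by rewrite /GRing.scale /= mulKf ?gt_eqF.
  exact: is_deriveZ.
- suff c : {within `[0, 1], continuous (fun x : R => x `^ b)}.
    by move=> s; apply: cvgM; [exact: cvg_cst|exact: c].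
  apply/(continuous_within_itvP _ ltr01); split.
  + by move=> x; rewrite in_itv/= => /andP[x0 _]; exact: continuous_powR_gt0.
  + by rewrite powR0 ?gt_eqF//; exact: powR_cvg0.
  + by apply/cvg_at_left_filter; exact: continuous_powR_gt0.
by rewrite powR0 ?gt_eqF// powR1 mulr0 mulr1 subr0.
Qed.

Lemma integral_powR_onem_01 (b : R) : 0 < b ->
  (\int[mu]_(x in `]0%R, 1%R[) ((1 - x) `^ (b - 1))%:E = (b^-1)%:E)%E.
Proof.
move=> b0; rewrite (@gt0_FTC2_oo _ (fun x => - b^-1 * (1 - x) `^ b))//; first last.
- by move=> s; rewrite in_itv/= => /andP[_ s0]; rewrite powR_gt0// subr_gt0.
- move=> x; rewrite in_itv/= => /andP[_ x0].
  apply: (@continuous_comp _ _ _ (fun x : R => 1 - x) (fun x : R => x `^ (b - 1))).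
    by apply: cvgB; [exact: cvg_cst|exact: cvg_id].
  by apply: continuous_powR_gt0; rewrite subr_gt0.
- move=> x; rewrite in_itv/= => /andP[_ x1].
  have y0 : 0 < 1 - x by rewrite subr_gt0.
  have h := is_derive1_powR b y0.
  have h' : is_derive x (1 : R) (fun x : R => 1 - x) (0 - 1) by exact: is_deriveB.
  have h2 := @is_derive1_comp R (fun x : R => x `^ b) (fun x : R => 1 - x) _ _ _ h h'.
  have -> : (1 - x) `^ (b - 1) = - b^-1 *: (b * (1 - x) `^ (b - 1) * (0 - 1)).
    by rewrite /GRing.scale /= sub0r mulrN1 mulrNN mulKf ?gt_eqF.
  exact: is_deriveZ.
- suff c : {within `[0, 1], continuous (fun x : R => (1 - x) `^ b)}.
    by move=> s; apply: cvgM; [exact: cvg_cst|exact: c].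
  have c x : x < 1 -> {for x, continuous (fun x : R => (1 - x) `^ b)}.
    move=> x1; apply: (@continuous_comp _ _ _ (fun x : R => 1 - x) (fun x : R => x `^ b)).
      by apply: cvgB; [exact: cvg_cst|exact: cvg_id].
    by apply: continuous_powR_gt0; rewrite subr_gt0.
  apply/(continuous_within_itvP _ ltr01); split.
  + by move=> x; rewrite in_itv/= => /andP[_]; exact: c.
  + by apply/cvg_at_right_filter; exact: c.
  + rewrite subrr powR0 ?gt_eqF//; apply: cvg_powR0 => //.
      by near=> x; rewrite subr_ge0; near: x; exact: nbhs_left_le.
    rewrite -[X in _ --> X](subrr (1 : R)); apply: cvgB; first exact: cvg_cst.
    exact: cvg_at_left_filter.
by rewrite subrr subr0 powR0 ?gt_eqF// powR1 mulr0 sub0r mulr1 opprK.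
Unshelve. all: by end_near. Qed.

Lemma powRV (x r : R) : 0 <= x -> x^-1 `^ r = x `^ (- r).
Proof. by move=> x0; rewrite -powR_inv1// -powRrM mulN1r. Qed.

Lemma measurable_funpowR d (T : measurableType d) (D : set T) (f : T -> R) (r : R) :
  measurable_fun D f -> measurable_fun D (fun x => f x `^ r).
Proof. by move=> mf; exact: (measurableT_comp (measurable_powR r) mf). Qed.

Lemma measurable_inv : measurable_fun setT (@GRing.inv R).
Proof.
rewrite -(setUv [set (0 : R)]); apply/measurable_funU => //; first exact: measurableC.
split; first exact: measurable_fun_set1.
apply: open_continuous_measurable_fun.
  by apply: closed_openC; exact: closed_eq.
by move=> x; rewrite inE/= => /eqP x0; exact: inv_continuous.
Qed.

Lemma measurable_funV d (T : measurableType d) (D : set T) (f : T -> R) :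
  measurable_fun D f -> measurable_fun D (fun x => (f x)^-1).
Proof. by move=> mf; exact: (measurableT_comp measurable_inv mf). Qed.

Lemma measurable_lnker d (T : measurableType d) (D : set T) (b : R) (f g : T -> R) :
  measurable_fun D f -> measurable_fun D g ->
  measurable_fun D (fun x => lnker b (f x) (g x)).
Proof.
move=> mf mg; apply: measurable_funM; last exact: measurable_funV.
apply: measurable_funpowR; apply: (measurableT_comp (@measurable_ln R)).
by apply: measurable_funM => //; exact: measurable_funV.
Qed.

Lemma beta_density_ge0 al x : 0 <= beta_density al x.
Proof. by rewrite mulr_ge0 ?powR_ge0. Qed.

Lemma measurable_beta_density al : measurable_fun setT (beta_density al).
Proof.
apply: measurable_funM; first exact: measurable_powR.
by apply: measurable_funpowR; exact: measurable_funB.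
Qed.

Lemma continuous_beta_density al x : 0 < x < 1 ->
  {for x, continuous (beta_density al)}.
Proof.
move=> /andP[x0 x1]; apply: cvgM; first exact: continuous_powR_gt0.
apply: (@continuous_comp _ _ _ (fun x : R => 1 - x) (fun x : R => x `^ (al - 1))).
  by apply: cvgB; [exact: cvg_cst|exact: cvg_id].
by apply: continuous_powR_gt0; rewrite subr_gt0.
Qed.

(** On each half of the unit interval one of the two factors is bounded by a
    power of 2, so the density is at most the sum of two integrable powers. *)
Lemma integral_beta_density_lty al : 0 < al < 1 ->
  (\int[mu]_(x in `]0%R, 1%R[) (beta_density al x)%:E < +oo)%E.
Proof.
move=> /andP[al0 al1].
pose f1 x : R := 2 `^ (1 - al) * x `^ ((1 - al) - 1).
pose f2 x : R := 2 `^ al * (1 - x) `^ (al - 1).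
have m1 : measurable_fun setT f1.
  by apply: measurable_funM => //; exact: measurable_powR.
have m2 : measurable_fun setT f2.
  apply: measurable_funM => //; apply: measurable_funpowR.
  exact: measurable_funB.
apply: (@le_lt_trans _ _ (\int[mu]_(x in `]0%R, 1%R[) ((f1 x)%:E + (f2 x)%:E))%E).
  apply: ge0_le_integral => //.
  - by move=> x _; rewrite lee_fin beta_density_ge0.
  - apply/measurable_EFinP; apply: measurable_funTS; exact: measurable_beta_density.
  - by apply: emeasurable_funD; apply/measurable_EFinP; apply: measurable_funTS.
  move=> x /=; rewrite in_itv/= => /andP[x0 x1].
  (* a power with exponent - r is largest at the left end of [1/2, 1] *)
  have k (y r : R) : 0 < r -> 2^-1 <= y -> y `^ (- r) <= 2 `^ r.
    move=> r0 y2; have y0 : 0 < y by lra.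
    rewrite -[2 in leRHS]invrK powRV//.
    rewrite !powRN lef_pV2 ?posrE ?powR_gt0//.
    by apply: ge0_ler_powR; rewrite ?nnegrE// ltW.
  rewrite -EFinD lee_fin /beta_density /f1 /f2.
  rewrite (_ : 1 - al - 1 = - al); last by ring.
  have [x2|x2] := leP x 2^-1.
    rewrite -[leLHS]addr0 lerD ?mulr_ge0 ?powR_ge0// mulrC ler_wpM2r ?powR_ge0//.
    rewrite (_ : al - 1 = - (1 - al)); last by ring.
    by apply: k; lra.
  rewrite -[leLHS]add0r lerD ?mulr_ge0 ?powR_ge0// ler_wpM2r ?powR_ge0//.
  by apply: k; lra.
rewrite ge0_integralD//; first last.
- by apply/measurable_EFinP; apply: measurable_funTS.
- by move=> x _; rewrite lee_fin mulr_ge0 ?powR_ge0.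
- by apply/measurable_EFinP; apply: measurable_funTS.
- by move=> x _; rewrite lee_fin mulr_ge0 ?powR_ge0.
apply: lte_add_pinfty.
- under eq_integral do rewrite EFinM.
  rewrite ge0_integralZl_EFin ?powR_ge0//; first last.
  + by apply/measurable_EFinP; apply: measurable_funTS; exact: measurable_powR.
  + by move=> x _; rewrite lee_fin powR_ge0.
  by rewrite integral_powR_01 ?ltry// subr_gt0.
- under eq_integral do rewrite EFinM.
  rewrite ge0_integralZl_EFin ?powR_ge0//; first last.
  + apply/measurable_EFinP; apply: measurable_funTS; apply: measurable_funpowR.
    exact: measurable_funB.
  + by move=> x _; rewrite lee_fin powR_ge0.
  by rewrite integral_powR_onem_01 ?ltry.
Qed.

(** The kernels of orders al and 1 - al compose to a constant multiple of the
    kernel of order 1: the substitution x = ln (s / v) / ln (t / v) reduces the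
    integral to the Beta integral of (1 - al, al), because the powers of
    ln (t / v) cancel.  So B depends on al only, which makes Abel's inversion
    exact. *)
Lemma integral_lnker_lnker (al : R) : 0 < al < 1 ->
  exists2 B : R, 0 <= B & forall v t, 0 < v < t ->
  (\int[mu]_(s in `]v, t[) (lnker al t s * lnker (1 - al) s v)%:E = (B / v)%:E)%E.
Proof.
move=> al01; have /andP[al0 al1] := al01.
have Blty := integral_beta_density_lty al01.
have B0 : (0 <= \int[mu]_(x in `]0%R, 1%R[) (beta_density al x)%:E)%E.
  by apply: integral_ge0 => x _; rewrite lee_fin beta_density_ge0.
exists (fine (\int[mu]_(x in `]0%R, 1%R[) (beta_density al x)%:E)%E).
  exact: fine_ge0.
move=> v t vt; have /andP[v0 vt'] := vt; have t0 := lt_trans v0 vt'.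
pose L := ln (t / v).
have L0 : 0 < L by exact: ln_div_gt0.
pose F s : R := L^-1 * ln (s / v).
pose f s : R := L^-1 * s^-1.
have Fv : F v = 0 by rewrite /F divff ?gt_eqF// ln1 mulr0.
have Ft : F t = 1 by rewrite /F mulVf// gt_eqF.
have dF (s : R) : 0 < s -> is_derive s (1 : R) F (f s).
  move=> s0; apply: is_deriveZ.
  exact: is_derive_ln_divl.
have H : (\int[mu]_(x in `]0%R, 1%R[) (beta_density al x)%:E =
    \int[mu]_(s in `]v, t[) (beta_density al (F s) * f s)%:E)%E.
  rewrite -Fv -Ft; apply: (@ge0_substitution_oo R F f (beta_density al)) => //.
  - apply: derivable_within_continuous => s; rewrite in_itv/= => /andP[vs _].
    by have h := dF _ (lt_le_trans v0 vs); exact: ex_derive.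
  - by move=> s; rewrite in_itv/= => /andP[vs _]; apply: dF; exact: lt_trans vs.
  - move=> s; rewrite in_itv/= => /andP[vs _].
    apply: cvgM; first exact: cvg_cst.
    by apply: cvgV => //; rewrite gt_eqF// (lt_trans v0).
  - move=> s; rewrite in_itv/= => /andP[vs _].
    by rewrite mulr_gt0 ?invr_gt0// (lt_trans v0).
  - by move=> y; rewrite Fv Ft in_itv/= => ?; exact: continuous_beta_density.
  - by move=> y _; exact: beta_density_ge0.
transitivity ((v^-1)%:E * \int[mu]_(s in `]v, t[) (beta_density al (F s) * f s)%:E)%E.
  rewrite -ge0_integralZl_EFin ?invr_ge0 ?ltW//.
  - apply: eq_integral => s; rewrite inE/= in_itv/= => /andP[vs st].
    have s0 := lt_trans v0 vs.
    rewrite -EFinM; congr EFin; rewrite /beta_density /lnker.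
    have -> : 1 - F s = L^-1 * ln (t / s).
      rewrite /F -{1}(mulVf (lt0r_neq0 L0)) -mulrBr /L !ln_div ?posrE//.
      by congr (_ * _); ring.
    have l1 : 0 <= ln (s / v) by rewrite ltW// ln_div_gt0// v0.
    have l2 : 0 <= ln (t / s) by rewrite ltW// ln_div_gt0// s0.
    rewrite /F !powRM ?invr_ge0 ?(ltW L0)// !powRV ?(ltW L0)// /f.
    rewrite (_ : 1 - al - 1 = - al); last by ring.
    have LE : L `^ (- - al) * L `^ (- (al - 1)) = L.
      rewrite -powRD; last by rewrite (gt_eqF L0) implybT.
      by rewrite (_ : _ + _ = 1); [rewrite powRr1// ltW|ring].
    transitivity (v^-1 * s^-1 * (ln (s / v) `^ (- al) * ln (t / s) `^ (al - 1)) *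
      (L `^ (- - al) * L `^ (- (al - 1)) * L^-1)); last by ring.
    by rewrite LE mulfV ?gt_eqF// mulr1; ring.
  - move=> s; rewrite /= in_itv/= => /andP[vs st].
    rewrite lee_fin mulr_ge0 ?beta_density_ge0// mulr_ge0 ?invr_ge0 ?ltW//.
    exact: lt_trans vs.
  - apply/measurable_EFinP; apply: measurable_funTS; apply: measurable_funM.
      apply: (measurableT_comp (measurable_beta_density al)).
      apply: measurable_funM => //; apply: (measurableT_comp (@measurable_ln R)).
      exact: measurable_funM.
    by apply: measurable_funM => //; exact: measurable_funV.
by rewrite -H EFinM muleC fineK// ge0_fin_numE.
Qed.

End beta.

(** * Convolutions with the kernel and Abel's inversion *)

Section convolution.
Context {R : realType}.
Notation mu := (@lebesgue_measure R).
Local Open Scope ereal_scope.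

(** Valued in the extended reals: for an integrable g it may be infinite at some
    points t, and there the real-valued Hadamard integral carries no
    information. *)
Definition lnconv (b a : R) (g : R -> R) (t : R) : \bar R :=
  \int[mu]_(s in `]a, t[) (lnker b t s * g s)%:E.

Variables (a : R) (g : R -> R).
Hypotheses (a0 : (0 < a)%R) (mg : measurable_fun setT g).
Hypothesis g0 : forall s, (0 <= g s)%R.

Let R2 := (measurableTypeR R * measurableTypeR R)%type.

Lemma lnconv_ge0 b t : 0 <= lnconv b a g t.
Proof.
apply: integral_ge0 => s /=; rewrite in_itv/= => /andP[as_ _].
by rewrite lee_fin mulr_ge0// lnker_ge0// ltW// (lt_trans a0).
Qed.

(** The domain of integration of the iterated integrals, outer variable first. *)
Let tri : set R2 := [set p | (a < p.2) && (p.2 < p.1)]%R.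

Let mtri : measurable tri.
Proof.
rewrite -[X in measurable X]setTI.
have : measurable_fun setT (fun p : R2 => (a < p.2) && (p.2 < p.1))%R.
  by apply: measurable_and; apply: measurable_fun_ltr.
by move=> /(_ measurableT [set true]); exact.
Qed.

Lemma measurable_lnconv b : measurable_fun setT (lnconv b a g).
Proof.
pose h : R2 -> \bar R := (fun p => (lnker b p.1 p.2 * g p.2)%:E) \_ tri.
have mh : measurable_fun setT h.
  apply/(measurable_restrictT _ mtri)/measurable_EFinP/measurable_funTS.
  apply: measurable_funM; first exact: measurable_lnker.
  by apply: (measurableT_comp mg).
have h0 p : 0 <= h p.
  apply: erestrict_ge0 => -[s v] /= /andP[av _].
  by rewrite lee_fin mulr_ge0// lnker_ge0// ltW// (lt_trans a0).
have := @measurable_fun_fubini_tonelli_F _ _ _ _ R mu h mh h0.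
congr (measurable_fun _ _); apply/funext => s.
rewrite /fubini_F /lnconv [RHS]integral_mkcond; apply: eq_integral => v _.
by rewrite /h !patchE /tri; congr (if _ then _ else _); apply/idP/idP;
  rewrite !inE/= in_itv/=.
Qed.

(** Abel's inversion: by Tonelli's theorem the kernels compose first, and by
    integral_lnker_lnker they compose to B / v. *)
Lemma integral_lnker_lnconv (al B t : R) :
  (forall v, (0 < v < t)%R ->
    \int[mu]_(s in `]v, t[) (lnker al t s * lnker (1 - al) s v)%:E = (B / v)%:E) ->
  \int[mu]_(s in `]a, t[) ((lnker al t s)%:E * lnconv (1 - al) a g s) =
  \int[mu]_(v in `]a, t[) (B / v * g v)%:E.
Proof.
move=> hB.
pose D : set R2 := tri `&` [set p | p.1 < t]%R.
have mD : measurable D.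
  apply: measurableI => //.
  have : measurable_fun setT (fun p : R2 => p.1 < t)%R by apply: measurable_fun_ltr.
  by move=> /(_ measurableT [set true]); rewrite setTI; exact.
pose h : R2 -> \bar R :=
  (fun p => (lnker al t p.1 * (lnker (1 - al) p.1 p.2 * g p.2))%:E) \_ D.
have mh : measurable_fun setT h.
  apply/(measurable_restrictT _ mD)/measurable_EFinP/measurable_funTS.
  apply: measurable_funM; first exact: measurable_lnker.
  apply: measurable_funM; first exact: measurable_lnker.
  by apply: (measurableT_comp mg).
have h0 p : 0 <= h p.
  apply: erestrict_ge0 => -[s v] /= [/andP[/= av vs] /= st].
  have v0 := lt_trans a0 av.
  rewrite lee_fin mulr_ge0 ?lnker_ge0 ?(ltW (lt_trans v0 vs))//.
  by rewrite mulr_ge0 ?lnker_ge0 ?(ltW v0).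
transitivity (\int[mu]_s \int[mu]_v h (s, v)).
  rewrite integral_mkcond; apply: eq_integral => s _.
  rewrite patchE; case: ifPn => [|].
    rewrite inE/= in_itv/= => /andP[as_ st].
    have s0 := lt_trans a0 as_.
    rewrite /lnconv -ge0_integralZl_EFin ?lnker_ge0 ?(ltW s0)//; last first.
    - apply/measurable_EFinP; apply: measurable_funTS; apply: measurable_funM => //.
      exact: measurable_lnker.
    - move=> v /=; rewrite in_itv/= => /andP[av _].
      by rewrite lee_fin mulr_ge0// lnker_ge0// ltW// (lt_trans a0).
    rewrite [LHS]integral_mkcond; apply: eq_integral => v _.
    rewrite /h !patchE; congr (if _ then _ else _).
    by apply/idP/idP; rewrite !inE/= in_itv/= /tri /=; [split|case].
  move=> /negP nst; rewrite integral0_eq// => v _.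
  rewrite /h patchE memNset// => -[/= /andP[/= av vs] st]; apply: nst.
  by rewrite inE/= in_itv/= st (lt_trans av).
transitivity (\int[mu]_v \int[mu]_s h (s, v)); first exact: (fubini_tonelli h).
rewrite [RHS]integral_mkcond; apply: eq_integral => v _.
rewrite patchE; case: ifPn => [|/negP nv]; last first.
  rewrite integral0_eq// => s _.
  rewrite /h patchE memNset// => -[/= /andP[/= av vs] st]; apply: nv.
  by rewrite inE/= in_itv/= av (lt_trans vs).
rewrite inE/= in_itv/= => /andP[av vt]; have v0 := lt_trans a0 av.
rewrite EFinM -hB ?v0// muleC -ge0_integralZl_EFin//; last first.
- apply/measurable_EFinP; apply: measurable_funTS; apply: measurable_funM;
    exact: measurable_lnker.
- move=> s /=; rewrite in_itv/= => /andP[vs _].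
  by rewrite lee_fin mulr_ge0 ?lnker_ge0 ?(ltW v0) ?(ltW (lt_trans v0 vs)).
rewrite [RHS]integral_mkcond; apply: eq_integral => s _.
rewrite /h !patchE /=; have -> : ((s, v) \in D) = (s \in `]v, t[%classic).
  apply/idP/idP; rewrite /D /tri !inE/= in_itv/=.
    by case=> /andP[_ ->] ->.
  by case/andP => -> ->; rewrite av.
by case: ifP => // _; rewrite -EFinM; congr EFin; ring.
Qed.

End convolution.

(** * A growing convolution forces a nonvanishing density *)

Section core.
Context {R : realType}.
Notation mu := (@lebesgue_measure R).

Lemma ge0_integral_itv_split (f : R -> \bar R) (x y z : R) : x < y -> y < z ->
  measurable_fun setT f -> (forall s, x < s -> (0 <= f s)%E) ->
  (\int[mu]_(s in `]x, z[) f s =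
   \int[mu]_(s in `]x, y[) f s + \int[mu]_(s in `]y, z[) f s)%E.
Proof.
move=> xy yz mf f0.
rewrite (@itv_bndbnd_setU _ _ (BRight x) (BLeft y) (BLeft z)); last 2 first.
- by rewrite bnd_simp.
- by rewrite bnd_simp ltW.
rewrite ge0_integral_setU//=; last 3 first.
- exact: measurable_funTS.
- move=> s [] /=; rewrite in_itv/= => /andP[h _]; apply: f0 => //.
  exact: lt_le_trans h.
- apply/disj_setPS => s [] /=; rewrite !in_itv/= => /andP[_ h1] /andP[h2 _].
  by have := lt_le_trans h1 h2; rewrite ltxx.
by rewrite -(integral_itv_obnd_cbnd _ (r := y))//; exact: measurable_funTS.
Qed.

(** A property true almost everywhere can be assumed at a point as close to y
    from the left as desired. *)
Lemma ae_ex_itv (P : R -> Prop) (x y : R) : x < y -> {ae mu, forall s, P s} ->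
  exists2 s, x < s < y & P s.
Proof.
move=> xy [N [mN N0 PN]]; apply: contrapT => nex.
have sub : `]x, y[ `<=` N.
  move=> s /=; rewrite in_itv/= => sxy; apply: PN => /= Ps.
  by apply: nex; exists s.
have : (mu `]x, y[ <= mu N)%E by apply: le_measure; rewrite ?inE.
rewrite [X in (_ <= X)%E]N0 lebesgue_measure_itv/= lte_fin xy -EFinD lee_fin.
by rewrite subr_le0 leNgt xy.
Qed.

Lemma ae_ge0_le_integral_comb d (T : measurableType d) (nu : {measure set T -> \bar R})
    (D : set T) (f1 f2 f3 h1 h2 : T -> \bar R) (k : R) : measurable D -> 0 <= k ->
  (forall s, D s -> [/\ 0 <= f1 s, 0 <= f2 s, 0 <= f3 s, 0 <= h1 s & 0 <= h2 s]%E) ->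
  [/\ measurable_fun D f1, measurable_fun D f2, measurable_fun D f3,
     measurable_fun D h1 & measurable_fun D h2] ->
  {ae nu, forall s, D s -> (f1 s + f2 s + k%:E * f3 s <= h1 s + k%:E * h2 s)%E} ->
  (\int[nu]_(s in D) f1 s + \int[nu]_(s in D) f2 s + k%:E * \int[nu]_(s in D) f3 s <=
   \int[nu]_(s in D) h1 s + k%:E * \int[nu]_(s in D) h2 s)%E.
Proof.
move=> mD k0 nng [mf1 mf2 mf3 mh1 mh2] le.
have f10 s : D s -> (0 <= f1 s)%E by case/nng.
have f20 s : D s -> (0 <= f2 s)%E by case/nng.
have f30 s : D s -> (0 <= f3 s)%E by case/nng.
have h10 s : D s -> (0 <= h1 s)%E by case/nng.
have h20 s : D s -> (0 <= h2 s)%E by case/nng.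
have kf30 s : D s -> (0 <= k%:E * f3 s)%E by move=> Ds; rewrite mule_ge0 ?f30.
have kh20 s : D s -> (0 <= k%:E * h2 s)%E by move=> Ds; rewrite mule_ge0 ?h20.
have f120 s : D s -> (0 <= f1 s + f2 s)%E by move=> Ds; rewrite adde_ge0 ?f10 ?f20.
have mkf3 : measurable_fun D (fun s => k%:E * f3 s)%E by exact: measurable_funeM.
have mkh2 : measurable_fun D (fun s => k%:E * h2 s)%E by exact: measurable_funeM.
have mf12 : measurable_fun D (fun s => f1 s + f2 s)%E by exact: emeasurable_funD.
rewrite -(ge0_integralZl_EFin _ _ f30)// -(ge0_integralZl_EFin _ _ h20)//.
rewrite -(ge0_integralD _ _ f10)// -(ge0_integralD _ _ f120)// -(ge0_integralD _ _ h10)//.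
apply: ae_ge0_le_integral => //.
- by move=> s Ds; rewrite adde_ge0 ?f120 ?kf30.
- exact: emeasurable_funD.
- by move=> s Ds; rewrite adde_ge0 ?h10 ?kh20.
- exact: emeasurable_funD.
Qed.

(** Let J be the convolution of g with the kernel of order 1 - al based at a, and
    P t the integral over ]a, t[ of the kernel of order al against J.  By Abel's
    inversion P t0 - P t1 is the integral of B g(v) / v over ]t1, t0[, which is
    o(t0 - t1) because g is small near t0.

    On the other hand P t0 - P t1 integrates J against the difference of the
    kernels of t0 and t1, which is positive on ]t1, t0[, negative on ]a, t1[, and
    has nonnegative total mass.  As J increases with slope at least c, replacing
    J by its value at t1 loses at least c |t1 - s| times the size of that
    difference, which is at least K (t0 - t1) for s < t1.  So
    P t0 - P t1 is at least kap (t0 - t1) for some kap > 0 independent of t1.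

    The slope is assumed only between points where J is finite; t1 is chosen
    among them, and they are almost all points by Abel's inversion again. *)
Lemma lnconv_growth_absurd (al a t0 c : R) (g : R -> R) :
  0 < al < 1 -> 0 < a < t0 -> 0 < c ->
  measurable_fun setT g -> (forall s, 0 <= g s) ->
  (\int[mu]_(s in `]a, t0[) (g s)%:E < +oo)%E ->
  (forall e, 0 < e -> exists2 d, d < t0 & forall s, d < s < t0 -> g s <= e) ->
  (forall s' s, a < s' -> s' < s -> s < t0 ->
    (lnconv (1 - al) a g s' < +oo)%E -> (lnconv (1 - al) a g s < +oo)%E ->
    (lnconv (1 - al) a g s' + (c * (s - s'))%:E <= lnconv (1 - al) a g s)%E) ->
  False.
Proof.
move=> al01 /andP[a0 at0] c0 mg g0 gint gsmall Jinc.
have /andP[al0 al1] := al01.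
have t00 := lt_trans a0 at0.
set J := lnconv (1 - al) a g in Jinc.
have J0 s : (0 <= J s)%E by exact: lnconv_ge0.
have mJ : measurable_fun setT J by exact: measurable_lnconv.
have [B B0 hB] := integral_lnker_lnker al01.
have Jabel t : (\int[mu]_(s in `]a, t[) ((lnker al t s)%:E * J s) =
    \int[mu]_(v in `]a, t[) (B / v * g v)%:E)%E.
  by apply: integral_lnker_lnconv => // v; exact: hB.
have mBg : measurable_fun setT (fun v : R => (B / v * g v)%:E).
  apply/measurable_EFinP; apply: measurable_funM => //.
  by apply: measurable_funM => //; exact: measurable_funV.
have Bg0 s : a < s -> (0 <= (B / s * g s)%:E)%E.
  by move=> as_; rewrite lee_fin mulr_ge0// divr_ge0// ltW// (lt_trans a0).
have mkJ t : measurable_fun setT (fun s : R => (lnker al t s)%:E * J s)%E.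
  by apply: emeasurable_funM => //; apply/measurable_EFinP; exact: measurable_lnker.
have mk b t : measurable_fun setT (fun s : R => (lnker b t s)%:E).
  by apply/measurable_EFinP; exact: measurable_lnker.
have k0 b t s : a < s -> 0 <= lnker b t s.
  by move=> as_; rewrite lnker_ge0// ltW// (lt_trans a0).
have kJ0 t s : a < s -> (0 <= (lnker al t s)%:E * J s)%E.
  by move=> as_; rewrite mule_ge0// lee_fin k0.
clearbody J.
have P0lty : (\int[mu]_(v in `]a, t0[) (B / v * g v)%:E < +oo)%E.
  apply: (@le_lt_trans _ _ (\int[mu]_(v in `]a, t0[) ((B / a)%:E * (g v)%:E))%E).
    apply: ge0_le_integral => //.
    - by move=> s /=; rewrite in_itv/= => /andP[as_ _]; exact: Bg0.
    - exact: measurable_funTS.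
    - apply: measurable_funTS; apply: emeasurable_funM => //.
      exact/measurable_EFinP.
    - move=> s /=; rewrite in_itv/= => /andP[as_ _].
      rewrite -EFinM lee_fin ler_wpM2r// ler_wpM2l//.
      by rewrite lef_pV2 ?posrE// ?(lt_trans a0)// ltW.
  rewrite ge0_integralZl_EFin//.
  - by rewrite lte_mul_pinfty// lee_fin divr_ge0// ltW.
  - by move=> s _; rewrite lee_fin.
  - by apply/measurable_EFinP; exact: measurable_funTS.
  - by rewrite divr_ge0// ltW.
have Jfin : {ae mu, forall s, `]a, t0[%classic s -> (J s < +oo)%E}.
  have I : mu.-integrable `]a, t0[ (fun s => (lnker al t0 s)%:E * J s)%E.
    apply/integrableP; split; first exact: (measurable_funTS (mkJ t0)).
    under eq_integral.
      move=> s; rewrite inE/= in_itv/= => /andP[as_ _].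
      rewrite gee0_abs ?kJ0//; over.
    by rewrite Jabel.
  have mD : measurable (`]a, t0[%classic : set (measurableTypeR R)) by [].
  have := integrable_ae mD I.
  apply: filterS => s + sat0; move=> /(_ sat0).
  move: sat0; rewrite /= in_itv/= => /andP[as_ st0].
  have kpos : 0 < lnker al t0 s by apply: lnker_gt0; rewrite st0 (lt_trans a0).
  have := J0 s; case: (J s) => [r _ _|_|]//; first exact: ltry.
  by rewrite gt0_muley ?lte_fin//=.
(* two fixed points, to keep t1 - s away from 0 when s < m and t1 > m2 *)
pose m := a + (t0 - a) / 3; pose m2 := a + (t0 - a) / 3 *+ 2.
have am : a < m by rewrite /m; lra.
have mm2 : m < m2 by rewrite /m /m2; lra.
have m2t0 : m2 < t0 by rewrite /m2; lra.
clearbody m m2.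
pose K := (1 - al) * ln (t0 / a) `^ (al - 2) / t0 / t0.
have K0 : 0 < K.
  have l : 0 < ln (t0 / a) by rewrite ln_div_gt0// a0.
  by rewrite !divr_gt0// mulr_gt0 ?subr_gt0// powR_gt0.
pose kap := K * (c * (m2 - m)) * (m - a).
have kap0 : 0 < kap.
  apply: mulr_gt0; last by rewrite subr_gt0.
  by apply: mulr_gt0 => //; apply: mulr_gt0; rewrite ?subr_gt0.
(* small enough for B / a * eps < kap; the + 1 is there because B may be 0 *)
pose eps := kap * a / ((B + 1) *+ 2).
have eps0 : 0 < eps.
  apply: divr_gt0; first exact: mulr_gt0.
  by rewrite pmulrn_lgt0// ltr_wpDl.
have Be : B / a * eps < kap.
  rewrite /eps.
  have -> : B / a * (kap * a / ((B + 1) *+ 2)) = kap * (B / ((B + 1) *+ 2)).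
    by rewrite mulr2n; field; rewrite ?gt_eqF//; lra.
  by rewrite gtr_pMr// ltr_pdivrMr ?mul1r; lra.
have [d dt0 gd] := gsmall _ eps0.
have [t1 /andP[t1l t1t0] J1] : exists2 t1, Num.max m2 d < t1 < t0 &
    `]a, t0[%classic t1 -> (J t1 < +oo)%E.
  by apply: ae_ex_itv => //; rewrite gt_max m2t0.
move: t1l; rewrite gt_max => /andP[m2t1 dt1].
have at1 : a < t1 by lra.
have {}J1 : (J t1 < +oo)%E by apply: J1; rewrite /= in_itv/= at1.
have [ga ga0 JE] : exists2 ga : R, 0 <= ga & J t1 = ga%:E.
  by exists (fine (J t1)); [exact: fine_ge0|rewrite fineK// ge0_fin_numE].
have mt1 : m < t1 by lra.
pose w s := (lnker al t1 s - lnker al t0 s) * (c * (t1 - s)).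
have Kw s : a < s -> s < t1 -> K * (t0 - t1) <= lnker al t1 s - lnker al t0 s.
  by move=> as_ st1; apply: lnkerB_lb => //; apply/andP.
clearbody K.
have dk0 s : a < s -> s < t1 -> 0 <= lnker al t1 s - lnker al t0 s.
  move=> as_ st1; apply: le_trans (Kw _ as_ st1).
  by rewrite mulr_ge0 ?(ltW K0)// subr_ge0 ltW.
have w0 s : a < s -> s < t1 -> 0 <= w s.
  move=> as_ st1; rewrite mulr_ge0 ?dk0// mulr_ge0 ?(ltW c0)//.
  by rewrite subr_ge0 ltW.
have mw : measurable_fun setT (fun s => (w s)%:E).
  apply/measurable_EFinP; apply: measurable_funM.
    by apply: measurable_funB; exact: measurable_lnker.
  by apply: measurable_funM => //; exact: measurable_funB.
have Kt0 : 0 <= K * (t0 - t1) by rewrite mulr_ge0 ?(ltW K0)// subr_ge0 ltW.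
have cm0 : 0 <= c * (m2 - m) by rewrite mulr_ge0 ?(ltW c0)// subr_ge0 ltW.
have W : ((kap * (t0 - t1))%:E <= \int[mu]_(s in `]a, t1[) (w s)%:E)%E.
  apply: (@le_trans _ _ (\int[mu]_(s in `]a, m[) (w s)%:E)%E); last first.
    apply: ge0_subset_integral => //.
    - exact: measurable_funTS.
    - by move=> s /=; rewrite in_itv/= => /andP[? ?]; rewrite lee_fin w0.
    - by apply: subset_itvl; rewrite bnd_simp ltW.
  apply: (@le_trans _ _ (\int[mu]_(s in `]a, m[) (K * (t0 - t1) * (c * (m2 - m)))%:E)%E).
    rewrite integral_cst//= lebesgue_measure_itv/= lte_fin am -EFinD -EFinM lee_fin.
    by rewrite le_eqVlt; apply/orP; left; apply/eqP; rewrite /kap; ring.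
  apply: ge0_le_integral => //.
  - by move=> s _; rewrite lee_fin mulr_ge0.
  - exact: measurable_funTS.
  - move=> s /=; rewrite in_itv/= => /andP[as_ sm]; have st1 := lt_trans sm mt1.
    rewrite lee_fin; apply: ler_pM; rewrite ?Kw//.
    by rewrite ler_wpM2l ?(ltW c0)// lerB// ltW.
(* J s against J t1 for s < t1, with all terms on the side where they are >= 0 *)
have key : (\int[mu]_(s in `]a, t1[) ((lnker al t1 s)%:E * J s) +
    \int[mu]_(s in `]a, t1[) (w s)%:E +
    ga%:E * \int[mu]_(s in `]a, t1[) (lnker al t0 s)%:E <=
    \int[mu]_(s in `]a, t1[) ((lnker al t0 s)%:E * J s) +
    ga%:E * \int[mu]_(s in `]a, t1[) (lnker al t1 s)%:E)%E.
  have itv s : `]a, t1[%classic s -> a < s by rewrite /= in_itv/= => /andP[].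
  have itv2 s : `]a, t1[%classic s -> s < t1 by rewrite /= in_itv/= => /andP[].
  apply: ae_ge0_le_integral_comb => //.
  - move=> s sD; have as_ := itv _ sD; have st1 := itv2 _ sD.
    by split; rewrite ?kJ0 ?lee_fin ?k0 ?w0.
  - split; [exact: (measurable_funTS (mkJ _))|exact: measurable_funTS|
      exact: (measurable_funTS (mk _ _))|exact: (measurable_funTS (mkJ _))|
      exact: (measurable_funTS (mk _ _))].
  - move: Jfin; apply: negligibleS => s /= nP Js; apply: nP => sD.
    have as_ := itv _ sD; have st1 := itv2 _ sD.
    have {}Js : (J s < +oo)%E by apply: Js; rewrite /= in_itv/= as_ (lt_trans st1).
    have JsE : J s = (fine (J s))%:E by rewrite fineK// ge0_fin_numE.
    have := Jinc s t1 as_ st1 t1t0 Js J1.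
    rewrite JE JsE -!EFinM -!EFinD !lee_fin => jle.
    have := ler_wpM2l (dk0 _ as_ st1) jle.
    rewrite -subr_ge0 => h; rewrite -subr_ge0; apply: le_trans h _.
    by rewrite le_eqVlt; apply/orP; left; apply/eqP; rewrite /w; ring.
have split0 : (\int[mu]_(s in `]a, t0[) ((lnker al t0 s)%:E * J s) =
    \int[mu]_(s in `]a, t1[) ((lnker al t0 s)%:E * J s) +
    \int[mu]_(s in `]t1, t0[) ((lnker al t0 s)%:E * J s))%E.
  by apply: ge0_integral_itv_split => // s; exact: kJ0.
have split1 : (\int[mu]_(s in `]a, t0[) (lnker al t0 s)%:E =
    \int[mu]_(s in `]a, t1[) (lnker al t0 s)%:E +
    \int[mu]_(s in `]t1, t0[) (lnker al t0 s)%:E)%E.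
  by apply: ge0_integral_itv_split => // s as_; rewrite lee_fin k0.
have split2 : (\int[mu]_(v in `]a, t0[) (B / v * g v)%:E =
    \int[mu]_(v in `]a, t1[) (B / v * g v)%:E +
    \int[mu]_(v in `]t1, t0[) (B / v * g v)%:E)%E.
  exact: ge0_integral_itv_split.
(* J s against J t1 for s > t1 *)
have last1 : (ga%:E * \int[mu]_(s in `]t1, t0[) (lnker al t0 s)%:E <=
    \int[mu]_(s in `]t1, t0[) ((lnker al t0 s)%:E * J s))%E.
  have itv s : `]t1, t0[%classic s -> t1 < s < t0 by rewrite /= in_itv.
  have at1s s : `]t1, t0[%classic s -> a < s by move=> /itv/andP[/(lt_trans at1)].
  rewrite -ge0_integralZl_EFin//; last 2 first.
  - by move=> s /at1s as_; rewrite lee_fin k0.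
  - exact: (measurable_funTS (mk _ _)).
  apply: ae_ge0_le_integral => //.
  - by move=> s /at1s as_; rewrite mule_ge0 ?lee_fin ?k0.
  - by apply: measurable_funeM; exact: (measurable_funTS (mk _ _)).
  - by move=> s /at1s as_; exact: kJ0.
  - exact: (measurable_funTS (mkJ _)).
  move: Jfin; apply: negligibleS => s /= nP Js; apply: nP => sD; have as_ := at1s _ sD.
  have /andP[t1s st0] := itv _ sD.
  have {}Js : (J s < +oo)%E by apply: Js; rewrite /= in_itv/= as_.
  rewrite (muleC ga%:E) -JE lee_wpmul2l ?lee_fin ?k0//.
  apply: le_trans (Jinc t1 s at1 t1s st0 J1 Js).
  by rewrite leeDl// lee_fin mulr_ge0 ?(ltW c0)// subr_ge0 ltW.
have last2 : (\int[mu]_(v in `]t1, t0[) (B / v * g v)%:E <=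
    (B / a * eps * (t0 - t1))%:E)%E.
  apply: (@le_trans _ _ (\int[mu]_(v in `]t1, t0[) (B / a * eps)%:E)%E); last first.
    by rewrite integral_cst//= lebesgue_measure_itv/= lte_fin t1t0 -EFinD -EFinM.
  have itv s : `]t1, t0[%classic s -> t1 < s < t0 by rewrite /= in_itv.
  apply: ge0_le_integral => //.
  - by move=> s /itv/andP[/(lt_trans at1) as_ _]; exact: Bg0.
  - exact: measurable_funTS.
  - move=> s /itv/andP[t1s st0]; have as_ := lt_trans at1 t1s.
    rewrite lee_fin; apply: ler_pM => //.
    + by rewrite divr_ge0// ltW// (lt_trans a0).
    + by rewrite ler_wpM2l// lef_pV2 ?posrE// ?(lt_trans a0)// ltW.
    + by apply: gd; rewrite st0 (lt_trans dt1).
rewrite integral_lnker ?a0// in split1.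
rewrite (integral_lnker (t := t1)) ?a0// in key.
rewrite (Jabel t0) in split0.
rewrite (Jabel t1) in key.
have fin1 (x y : \bar R) : (0 <= x -> 0 <= y -> x + y < +oo ->
    x \is a fin_num /\ y \is a fin_num)%E.
  by move: x y => [x||] [y||].
have Y0 : (0 <= \int[mu]_(v in `]a, t1[) (B / v * g v)%:E)%E.
  by apply: integral_ge0 => s; rewrite /= in_itv/= => /andP[/Bg0].
have Z0 : (0 <= \int[mu]_(v in `]t1, t0[) (B / v * g v)%:E)%E.
  by apply: integral_ge0 => s; rewrite /= in_itv/= => /andP[/(lt_trans at1)/Bg0].
have X10 : (0 <= \int[mu]_(s in `]a, t1[) ((lnker al t0 s)%:E * J s))%E.
  by apply: integral_ge0 => s; rewrite /= in_itv/= => /andP[/kJ0].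
have X20 : (0 <= \int[mu]_(s in `]t1, t0[) ((lnker al t0 s)%:E * J s))%E.
  by apply: integral_ge0 => s; rewrite /= in_itv/= => /andP[/(lt_trans at1)/kJ0].
have L10 : (0 <= \int[mu]_(s in `]a, t1[) (lnker al t0 s)%:E)%E.
  by apply: integral_ge0 => s; rewrite /= in_itv/= lee_fin => /andP[/k0].
have L20 : (0 <= \int[mu]_(s in `]t1, t0[) (lnker al t0 s)%:E)%E.
  by apply: integral_ge0 => s; rewrite /= in_itv/= lee_fin => /andP[/(lt_trans at1)/k0].
(* the total mass of the difference of the kernels is nonnegative *)
have qq : ln (t1 / a) `^ al / al <= ln (t0 / a) `^ al / al.
  rewrite ler_pM2r ?invr_gt0//; apply: ge0_ler_powR; rewrite ?nnegrE ?(ltW al0)//.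
  - by rewrite ltW// ln_div_gt0// a0.
  - by rewrite ltW// ln_div_gt0// a0.
  - have t10 := lt_trans a0 at1.
    by rewrite ler_ln ?posrE ?divr_gt0// ler_wpM2r ?invr_ge0 ?(ltW a0) ?(ltW t1t0).
rewrite -(ltr_pM2r (x := t0 - t1)) ?subr_gt0// in Be.
move: split0; rewrite split2 => split0.
rewrite split2 in P0lty.
have [Yf Zf] := fin1 _ _ Y0 Z0 P0lty.
rewrite split0 in P0lty.
have [X1f X2f] := fin1 _ _ X10 X20 P0lty.
have Llty := ltry (ln (t0 / a) `^ al / al); rewrite split1 in Llty.
have [L1f L2f] := fin1 _ _ L10 L20 Llty.
have {}key := le_trans (leeD (leeD (lexx _) W) (lexx _)) key.
rewrite -(fineK Yf) -(fineK X1f) -(fineK L1f) -!EFinM -!EFinD lee_fin in key.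
rewrite -(fineK Yf) -(fineK Zf) -(fineK X1f) -(fineK X2f) -!EFinD in split0.
rewrite -(fineK L1f) -(fineK L2f) -!EFinD in split1.
rewrite -(fineK L2f) -(fineK X2f) -EFinM lee_fin in last1.
rewrite -(fineK Zf) lee_fin in last2.
case: split0 => split0; case: split1 => split1.
have h := ler_wpM2l ga0 qq.
rewrite split1 mulrDr in h.
move: key split0 last1 last2 Be h; clear.
move: (fine _) (fine _) (fine _) (fine _) (fine _) (fine _) => x1 y l1 z x2 l2.
move: (kap * _) (B / a * _ * _) (ga * _) (ga * _) (ga * _) => u v w1 w2 w3.
by move=> *; lra.
Qed.

End core.

(** * The inequality at a maximum *)

Section maximum.
Context {R : realType}.
Notation mu := (@lebesgue_measure R).

(** For t > a the kernel is bounded on ]x, a[, away from its singularity t. *)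
Lemma integral_lnker_far_lty (b x a t : R) (g : R -> R) : b <= 1 ->
  0 < x -> x < a -> a < t ->
  measurable_fun setT g -> (forall s, 0 <= g s) ->
  (\int[mu]_(s in `]x, a[) (g s)%:E < +oo)%E ->
  (\int[mu]_(s in `]x, a[) (lnker b t s * g s)%:E < +oo)%E.
Proof.
move=> b1 x0 xa at_ mg g0 gint; have a0 := lt_trans x0 xa; have t0 := lt_trans a0 at_.
pose C := ln (t / a) `^ (b - 1) / x.
have C0 : 0 <= C by rewrite divr_ge0 ?powR_ge0// ltW.
apply: (@le_lt_trans _ _ (\int[mu]_(s in `]x, a[) (C%:E * (g s)%:E))%E).
  apply: ge0_le_integral => //.
  - move=> s /=; rewrite in_itv/= => /andP[xs _].
    by rewrite lee_fin mulr_ge0// lnker_ge0// ltW// (lt_trans x0).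
  - apply/measurable_EFinP; apply: measurable_funTS; apply: measurable_funM => //.
    exact: measurable_lnker.
  - apply: measurable_funeM; apply: measurable_funTS; exact/measurable_EFinP.
  - move=> s /=; rewrite in_itv/= => /andP[xs sa]; have s0 := lt_trans x0 xs.
    rewrite -EFinM lee_fin ler_wpM2r//.
    have la : 0 < ln (t / a) by rewrite ln_div_gt0// a0.
    have ls : 0 < ln (t / s) by rewrite ln_div_gt0// s0 (lt_trans sa).
    apply: ler_pM; rewrite ?powR_ge0 ?invr_ge0 ?(ltW s0)//; last first.
      by rewrite lef_pV2 ?posrE// ltW.
    rewrite -opprB !powRN lef_pV2 ?posrE ?powR_gt0//.
    apply: ge0_ler_powR; rewrite ?nnegrE ?subr_ge0 ?(ltW la) ?(ltW ls)//.
    rewrite ler_ln ?posrE ?divr_gt0//.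
    by rewrite ler_wpM2l ?(ltW t0)// lef_pV2 ?posrE ?(ltW sa).
rewrite ge0_integralZl_EFin//.
- by rewrite lte_mul_pinfty// lee_fin.
- by move=> s _; rewrite lee_fin.
- by apply/measurable_EFinP; exact: measurable_funTS.
Qed.

(** Inside the interval the relative difference quotient is the usual one. *)
Lemma is_derive_derive_in (x T0 T1 : R) (F : R -> R) : T0 < x < T1 ->
  derivable_in `[T0, T1] F x -> is_derive x (1 : R) F (derive_in `[T0, T1] F x).
Proof.
move=> xT; rewrite /derivable_in => dF.
set l := derive_in _ _ _.
have {}dF : diff_quot F x @ within `[T0, T1] x^' --> l by exact: dF.
have H : (fun h : R => h^-1 *: ((F \o shift x) (h *: (1 : R)) - F x)) @ 0^' --> l.
  apply/cvgrPdist_le => e e0.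
  have /cvgrPdist_le /(_ e e0) := dF.
  have : \forall s \near x, s \in `]T0, T1[ by apply: near_in_itvoo; rewrite in_itv.
  move=> [d1 /= d10 H1] [d2 /= d20 H2].
  exists (Num.min d1 d2) => /=; first by rewrite lt_min d10.
  move=> h; rewrite /ball_ /= sub0r normrN lt_min => /andP[hd1 hd2] h0.
  have E : h *: (1 : R) + x - x = h by rewrite addrK /GRing.scale /= mulr1.
  have := H2 (h *: 1 + x); rewrite /diff_quot /ball_ /= E.
  have -> : x - (h *: (1 : R) + x) = - h by rewrite -[in RHS]E opprB.
  rewrite normrN => /(_ hd2) H3.
  rewrite /= /GRing.scale /= [_^-1 * _]mulrC; apply: H3.
    by rewrite /GRing.scale /= mulr1; apply: contra_neq h0; lra.
  have : h *: (1 : R) + x \in `]T0, T1[.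
    apply: H1; rewrite /ball_ /=.
    by have -> : x - (h *: (1 : R) + x) = - h; [rewrite -[in RHS]E opprB|rewrite normrN].
  exact: subset_itv_oo_cc.
apply: DeriveDef; first by apply/cvg_ex; exists l.
exact/cvg_lim.
Qed.

Lemma Gamma_ge0 (z : R) : 0 <= Gamma z.
Proof.
by apply: Rintegral_ge0 => x _; rewrite mulr_ge0 ?powR_ge0 ?expR_ge0.
Qed.

(** The Hadamard integral of the constant c0 is explicit.  Finiteness of the
    convolution is needed: otherwise the integral of f is infinite, and its
    real-valued version is 0 by convention. *)
Lemma hadamard_intE (b c0 t : R) (f g : R -> R) : 0 < b -> 1 < t ->
  measurable_fun setT g -> (forall s, 0 <= g s) ->
  measurable_fun `]1, t[ f ->
  {in `]1, t[, forall s, f s = c0 - g s} ->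
  (lnconv b 1 g t < +oo)%E ->
  hadamard_int b f t =
    (Gamma b)^-1 * (c0 * (ln t `^ b / b) - fine (lnconv b 1 g t)).
Proof.
move=> b0 t1 mg g0 mf fE Gfin; congr (_ * _).
have nn s : `]1, t[%classic s -> 0 < s.
  by rewrite /= in_itv/= => /andP[/(lt_trans ltr01)].
have mD : measurable (`]1, t[%classic : set (measurableTypeR R)) by [].
have mk : measurable_fun (`]1, t[ : set R) (lnker b t) by exact: measurable_lnker.
have Ik : mu.-integrable `]1, t[ (EFin \o lnker b t).
  apply/integrableP; split; first exact/measurable_EFinP.
  under eq_integral.
    move=> s; rewrite inE => /nn s0.
    rewrite gee0_abs ?lee_fin ?lnker_ge0 ?(ltW s0)//; over.
  by rewrite integral_lnker ?ltr01 ?ltry.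
have Ikc : mu.-integrable `]1, t[ (EFin \o (fun s => c0 * lnker b t s)).
  have := integrableZl mD c0 Ik.
  by apply: eq_integrable => // s _; rewrite /= EFinM.
have nng s : `]1, t[%classic s -> 0 <= lnker b t s * g s.
  by move=> /nn s0; apply: mulr_ge0 => //; exact/lnker_ge0/ltW.
have Ig : mu.-integrable `]1, t[ (EFin \o (fun s => lnker b t s * g s)).
  apply/integrableP; split.
    by apply/measurable_EFinP; apply: (measurable_funM mk); exact: (measurable_funTS mg).
  under eq_integral.
    move=> s; rewrite inE => sI.
    rewrite gee0_abs ?lee_fin ?nng//; over.
  exact: Gfin.
rewrite /Rintegral integral_itv_bndoo; last first.
  apply/measurable_EFinP; apply: measurable_funM; last exact: measurable_funV.
  apply: measurable_funM => //; apply: measurable_funpowR.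
  apply: (measurableT_comp (@measurable_ln R)).
  by apply: measurable_funM => //; exact: measurable_funV.
have -> : (\int[mu]_(s in `]1%R, t[) (ln (t / s) `^ (b - 1) * f s / s)%:E =
    \int[mu]_(s in `]1%R, t[) (c0 * lnker b t s - lnker b t s * g s)%:E)%E.
  apply: eq_integral => s; rewrite inE => sI; congr EFin.
  by rewrite fE// /lnker; ring.
rewrite (integralB_EFin _ Ikc Ig)// fineB; last 2 first.
- exact: integrable_fin_num Ikc.
- exact: integrable_fin_num Ig.
congr (_ - _).
have := integralZl mD Ik c0.
rewrite /= integral_lnker ?ltr01// divr1 => E.
by under eq_integral do rewrite EFinM; rewrite E.
Qed.

Lemma within_cvg_left (A : set R) (h : R -> R) (t0 b : R) :
  `]b, t0[ `<=` A -> b < t0 -> h @ within A (nbhs t0) --> h t0 ->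
  forall P : R -> Prop, (\forall y \near h t0, P y) ->
  exists2 d, b <= d < t0 & forall x, d < x < t0 -> P (h x).
Proof.
move=> bA bt0 ch P nP.
have [e /= e0 H] := ch _ nP.
exists (Num.max b (t0 - e)).
  by rewrite le_max lexx/= gt_max bt0/= ltrBlDr ltrDl.
move=> x; rewrite gt_max -andbA => /and3P[bx ex xt0]; apply: H.
  by rewrite /ball_/= gtr0_norm ?subr_gt0//; lra.
by apply: bA; rewrite /= in_itv/= bx.
Qed.

(** If x + y increases and x decreases, then y increases at least as much. *)
Lemma lee_of_sum_increment (c k u : R) (x x' y y' : \bar R) : 0 < k ->
  (0 <= x < +oo)%E -> (0 <= x' < +oo)%E -> (0 <= y < +oo)%E -> (0 <= y' < +oo)%E ->
  (x <= x')%E -> c * u <= k * fine (x + y)%E - k * fine (x' + y')%E ->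
  (y' + (c / k * u)%:E <= y)%E.
Proof.
have fin (z : \bar R) : (0 <= z < +oo)%E -> z = (fine z)%:E.
  by case/andP => ? ?; rewrite fineK// ge0_fin_numE.
move=> k0 /fin-> /fin-> /fin-> /fin->.
move: (fine x) (fine x') (fine y) (fine y') => {x x' y y'} x x' y y'.
rewrite -!EFinD !lee_fin /= => xx' h.
have : k * (c / k * u) <= k * (x + y - (x' + y')).
  by rewrite mulrBr [leLHS](_ : _ = c * u)//; field; rewrite gt_eqF.
by rewrite ler_pM2l// => {}h; lra.
Qed.

(** Moving the base point from x up to a removes the contribution of ]x, a[,
    which is finite and, the kernel being nonincreasing in t, nonincreasing.  So
    lower bounds for increments are preserved. *)
Lemma lnconv_rebase (b x a c k : R) (g : R -> R) (s' s : R) : b <= 1 ->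
  0 < x -> x < a -> a < s' -> s' < s -> 0 < k ->
  measurable_fun setT g -> (forall v, 0 <= g v) ->
  (\int[mu]_(v in `]x, a[) (g v)%:E < +oo)%E ->
  (lnconv b a g s' < +oo)%E -> (lnconv b a g s < +oo)%E ->
  ((lnconv b x g s' < +oo)%E -> (lnconv b x g s < +oo)%E ->
    c * (s - s') <= k * fine (lnconv b x g s) - k * fine (lnconv b x g s')) ->
  (lnconv b a g s' + (c / k * (s - s'))%:E <= lnconv b a g s)%E.
Proof.
move=> b1 x0 xa as' s's k0 mg g0 gint; have as_ := lt_trans as' s's.
have a0 := lt_trans x0 xa.
pose G1 t := (\int[mu]_(v in `]x, a[) (lnker b t v * g v)%:E)%E.
have mkg t : measurable_fun setT (fun v : R => (lnker b t v * g v)%:E).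
  by apply/measurable_EFinP; apply: measurable_funM => //; exact: measurable_lnker.
have kg0 t v : x < v -> (0 <= (lnker b t v * g v)%:E)%E.
  by move=> xv; rewrite lee_fin mulr_ge0// lnker_ge0// ltW// (lt_trans x0).
have GE t : a < t -> lnconv b x g t = (G1 t + lnconv b a g t)%E.
  by move=> at_; apply: ge0_integral_itv_split => //; exact: kg0.
have G10 t : (0 <= G1 t)%E.
  by apply: integral_ge0 => v; rewrite /= in_itv/= => /andP[/kg0].
have G1fin t : a < t -> (G1 t < +oo)%E.
  by move=> at_; apply: integral_lnker_far_lty.
have G1le : (G1 s <= G1 s')%E.
  apply: ge0_le_integral => //.
  - by move=> v; rewrite /= in_itv/= => /andP[/kg0].
  - exact: (measurable_funTS (mkg s)).
  - exact: (measurable_funTS (mkg s')).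
  - move=> v; rewrite /= in_itv/= => /andP[xv va].
    by rewrite lee_fin ler_wpM2r// lnker_nincr// (lt_trans x0 xv) (lt_trans va).
have J0 t : (0 <= lnconv b a g t)%E by exact: lnconv_ge0.
have := GE _ as'; have := GE _ as_.
have := G1fin _ as_; have := G1fin _ as'; have := G10 s; have := G10 s'.
have := J0 s; have := J0 s'; move: G1le.
move: (G1 s) (G1 s') (lnconv b a g s) (lnconv b a g s').
move: (lnconv b x g s) (lnconv b x g s'); clear -k0.
move=> w w' y y' z z' yy' z'0 z0 y'0 y0 y'oo yoo -> -> z'oo zoo h.
apply: (@lee_of_sum_increment c k (s - s') y y') => //.
- by rewrite y0.
- by rewrite y'0.
- by rewrite z0.
- by rewrite z'0.
- by apply: h; rewrite lte_add_pinfty.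
Qed.

(** The function psi is the derivative of Phi, and Phi = k G wherever G is finite.
    So psi t0 > 0, the negation of the claim, bounds the increments of G near t0
    from below by a multiple of those of the variable, and lnconv_rebase and
    lnconv_growth_absurd apply. *)
Lemma hadamard_der_max_ge (T al t0 : R) (f : R -> R) : 0 < al < 1 -> 1 < t0 <= T ->
  mu.-integrable `[1, T] (EFin \o f) ->
  C1_in `[1, T] (hadamard_int (1 - al) f) ->
  f @ within `[1, T] (nbhs t0) --> f t0 ->
  (forall t, 1 <= t <= T -> f t <= f t0) ->
  (Gamma (1 - al))^-1 * ln t0 `^ (- al) * f t0 <= hadamard_der T al f t0.
Proof.
move=> al01 /andP[t01 t0T] If [dF cF] cf fmax; have /andP[al0 al1] := al01.
have t00 : 0 < t0 by exact: lt_trans t01.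
have b0 : 0 < 1 - al by rewrite subr_gt0.
set k := (Gamma (1 - al))^-1; have k0 : 0 <= k by rewrite invr_ge0 Gamma_ge0.
rewrite /hadamard_der leNgt; apply/negP => Dlt.
set F := hadamard_int (1 - al) f in dF cF Dlt.
pose c0 := f t0; pose A : set R := `[1, T]%classic.
pose q x : R := k * c0 * ln x `^ (- al) * x^-1.
pose psi x : R := q x - derive_in A F x.
have subA : `]1, t0[ `<=` A.
  by apply: subset_itv; rewrite bnd_simp.
have At0 : A t0 by rewrite /A /= in_itv/= t0T ltW.
have psi0 : 0 < psi t0.
  rewrite subr_gt0 /q ltr_pdivlMr// mulrC (lt_le_trans Dlt)// /c0.
  by rewrite le_eqVlt; apply/orP; left; apply/eqP; ring.
have cpsi : psi @ within A (nbhs t0) --> psi t0.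
  apply: cvgB; last first.
    by move/subspace_continuousP : cF; exact.
  apply: cvg_within_filter.
  apply: cvgM; last by apply: cvgV; [rewrite gt_eqF|exact: cvg_id].
  apply: cvgM; first exact: cvg_cst.
  apply: (@continuous_comp _ _ _ (@ln R) (fun x : R => x `^ (- al))).
    exact: continuous_ln.
  by apply: continuous_powR_gt0; rewrite ln_gt0.
pose c := psi t0 / 2.
have cpos : 0 < c by rewrite divr_gt0.
(* the lower bound (1 + t0) / 2 only serves to keep a away from 1 *)
have [a /andP[a1 at0] psic] : exists2 a, (1 + t0) / 2 <= a < t0 &
    forall x, a < x < t0 -> c < psi x.
  apply: (@within_cvg_left A psi t0 ((1 + t0) / 2) _ _ cpsi (fun y => c < y)).
  - by move=> x xI; apply: subA; apply: subset_itvr xI; rewrite bnd_simp; lra.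
  - by lra.
  - by apply: lt_nbhsr; rewrite /c; lra.
have {}a1 : 1 < a by lra.
have a0 : 0 < a by lra.
pose Phi x : R := k * c0 / (1 - al) * ln x `^ (1 - al) - F x.
have dPhi x : 1 < x < t0 -> is_derive x (1 : R) Phi (psi x).
  move=> /andP[x1 xt0]; have x0 : 0 < x by exact: lt_trans x1.
  have h1 := is_derive1_ln x0.
  have lx : 0 < ln x by exact: ln_gt0.
  have h2 := is_derive1_powR (1 - al) lx.
  have h3 := @is_derive1_comp R (fun x : R => x `^ (1 - al)) (@ln R) _ _ _ h2 h1.
  have xT : 1 < x < T by rewrite x1 (lt_le_trans xt0).
  have h4 := is_derive_derive_in xT (dF x (subA x (introT andP (conj x1 xt0)))).
  apply: is_deriveB; rewrite /q.
  have -> : k * c0 * ln x `^ (- al) / x =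
      (k * c0 / (1 - al)) *: ((1 - al) * ln x `^ (1 - al - 1) * x^-1).
    rewrite /GRing.scale /= (_ : 1 - al - 1 = - al); last by ring.
    by field; rewrite !gt_eqF//.
  exact: is_deriveZ.
have incPhi s' s : a < s' -> s' < s -> s < t0 -> c * (s - s') <= Phi s - Phi s'.
  move=> as' s's st0.
  have [||xi] := @MVT R Phi psi s' s s's.
  - move=> x; rewrite in_itv/= => /andP[s'x xs]; apply: dPhi.
    by rewrite (lt_trans a1 (lt_trans as' s'x)) (lt_trans xs).
  - apply: derivable_within_continuous => x; rewrite in_itv/= => /andP[s'x xs].
    have x1t : 1 < x < t0.
      by rewrite (lt_trans a1 (lt_le_trans as' s'x)) (le_lt_trans xs).
    by have h := dPhi x x1t; exact: ex_derive.
  rewrite in_itv/= => /andP[s'xi xis] ->.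
  apply: ler_wpM2r; first by rewrite subr_ge0 ltW.
  by apply/ltW/psic; rewrite (lt_trans as' s'xi) (lt_trans xis).
have kpos : 0 < k.
  (* for k = 0 the function Phi vanishes, which contradicts incPhi *)
  rewrite lt_neqAle k0 andbT; apply/eqP => /esym k_0.
  have F0 x : F x = 0 by rewrite /F /hadamard_int -/k k_0 mul0r.
  have Phi0 x : Phi x = 0 by rewrite /Phi F0 k_0 !mul0r subrr.
  pose s' := (a + t0) / 2; pose s := (s' + t0) / 2.
  have as' : a < s' by rewrite /s'; lra.
  have s's : s' < s by rewrite /s; rewrite /s' in as' *; lra.
  have st0 : s < t0 by rewrite /s /s'; lra.
  have := incPhi s' s as' s's st0; rewrite !Phi0 subrr.
  by rewrite leNgt mulr_gt0// subr_gt0.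
have mA : measurable (A : set (measurableTypeR R)) by exact: measurable_itv.
have mfA : measurable_fun A f by case/integrableP : If => /measurable_EFinP.
pose g : R -> R := (fun s => c0 - f s) \_ A.
have mg : measurable_fun setT g.
  by apply/(measurable_restrictT _ mA); exact: measurable_funB.
have gE s : A s -> g s = c0 - f s by move=> As; rewrite /g patchE mem_set.
have g0 s : 0 <= g s.
  rewrite /g patchE; case: ifPn => //; rewrite inE /A /= in_itv/= => sA.
  by rewrite subr_ge0 fmax.
have gint (x y : R) : `]x, y[ `<=` A -> (\int[mu]_(s in `]x, y[) (g s)%:E < +oo)%E.
  move=> xyA.
  have I : mu.-integrable A (fun s => c0%:E - (f s)%:E)%E.
    apply: integrableB => //.
    apply: (@continuous_compact_integrable _ (cst c0)); first exact: segment_compact.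
    exact/continuous_subspaceT/cst_continuous.
  have mD : measurable (`]x, y[%classic : set (measurableTypeR R)) by [].
  have := integrable_lty mD (integrableS mA mD xyA I).
  congr (_ < _)%E; apply: eq_integral => s; rewrite inE => /xyA As.
  by rewrite gE.
pose G := lnconv (1 - al) 1 g.
have PhiE s : 1 < s -> s < t0 -> (G s < +oo)%E -> Phi s = k * fine (G s).
  move=> s1 st0 Gs; rewrite /Phi /F (@hadamard_intE _ c0 s f g)//; last first.
  - move=> v; rewrite inE/= => vI; rewrite gE; first by ring.
    by apply: subA; apply: subset_itvl vI; rewrite bnd_simp ltW.
  - apply: measurable_funS mfA => // v vI.
    by apply: subA; apply: subset_itvl vI; rewrite bnd_simp ltW.
  - by rewrite -/k -/G; ring.
apply: (@lnconv_growth_absurd R al a t0 (c / k) g) => //.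
- by rewrite a0.
- by rewrite divr_gt0.
- by apply: gint => v va; apply: subA; apply: subset_itvr va; rewrite bnd_simp ltW.
- move=> e e0.
  have ne : \forall y \near f t0, c0 - e < y.
    by apply: lt_nbhsr; rewrite ltrBlDr ltrDl.
  have [d /andP[d1 dt0] fd] := within_cvg_left subA t01 cf ne.
  exists d => // s /andP[ds st0].
  rewrite gE; last by apply: subA; rewrite /= in_itv/= (le_lt_trans d1).
  by rewrite lerBlDr -lerBlDl ltW// fd// ds.
- move=> s' s as' s's st0 Js' Js; have as_ := lt_trans as' s's.
  have s'1 := lt_trans a1 as'; have s1 := lt_trans a1 as_.
  apply: (@lnconv_rebase (1 - al) 1 a c k g s' s) => //.
  + by lra.
  + by apply: gint => v va; apply: subA; apply: subset_itvl va; rewrite bnd_simp ltW.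
  + move=> Gs' Gs; have := incPhi s' s as' s's st0.
    by rewrite (PhiE s s1 st0 Gs) (PhiE s' s'1 (lt_trans s's st0) Gs').
Qed.



End maximum.

(** * Passing to the opposite function *)

Section opposite.
Context {R : realType}.
Notation mu := (@lebesgue_measure R).

(** No integrability is required: when the positive and the negative parts both
    have infinite integral, both sides are 0. *)
Lemma RintegralN d (T : measurableType d) (nu : {measure set T -> \bar R}) (D : set T)
    (h : T -> R) :
  \int[nu]_(s in D) (- h s) = - \int[nu]_(s in D) h s.
Proof.
rewrite /Rintegral integralE [in RHS]integralE.
have -> : (fun s => (- h s)%:E) = (\- (EFin \o h))%E by [].
rewrite funeposN funenegN.
have : (0 <= \int[nu]_(s in D) (EFin \o h)^\+ s)%E by exact: integral_ge0.
have : (0 <= \int[nu]_(s in D) (EFin \o h)^\- s)%E by exact: integral_ge0.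
move: (\int[_]_(_ in _) _)%E (\int[_]_(_ in _) _)%E => [x||] [y||] //= _ _.
all: by rewrite ?opprB ?oppr0.
Qed.

Lemma hadamard_intN (b : R) (f : R -> R) :
  hadamard_int b (\- f) = \- hadamard_int b f.
Proof.
apply/funext => t; rewrite /hadamard_int /= -mulrN; congr (_ * _).
by rewrite -RintegralN; apply: eq_Rintegral => s _; rewrite /= mulrN mulNr.
Qed.

(** Limits in derive_in are meaningful only because no point of a nondegenerate
    interval is isolated in it. *)
Lemma punctured_proper (T0 T1 x : R) : T0 < T1 -> `[T0, T1]%classic x ->
  ProperFilter (within `[T0, T1] x^').
Proof.
move=> T01; rewrite /= in_itv/= => /andP[x0 x1].
apply: Build_ProperFilter_ex => P [e /= e0 H].
have [xT|Tx] := ltP x T1.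
  pose h := Num.min (e / 2) (T1 - x).
  have h0 : 0 < h by rewrite lt_min subr_gt0 xT divr_gt0.
  have he : h < e by rewrite gt_min ltr_pdivrMr// ltr_pMr// ltr1n.
  have hT : h <= T1 - x by rewrite ge_min lexx orbT.
  exists (x + h); apply: H.
  - by rewrite /ball_ /= opprD addNKr normrN gtr0_norm.
  - by rewrite gt_eqF// ltrDl.
  - by rewrite /= in_itv/=; lra.
pose h := Num.min (e / 2) (x - T0).
have h0 : 0 < h by rewrite lt_min divr_gt0//=; lra.
have he : h < e by rewrite gt_min ltr_pdivrMr// ltr_pMr// ltr1n.
have hT : h <= x - T0 by rewrite ge_min lexx orbT.
exists (x - h); apply: H.
- by rewrite /ball_ /= opprB addrCA subrr addr0 gtr0_norm.
- by rewrite lt_eqF// ltrBlDr ltrDl.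
- by rewrite /= in_itv/=; lra.
Qed.

Lemma cvg_diff_quotN (T0 T1 x : R) (F : R -> R) : derivable_in `[T0, T1] F x ->
  diff_quot (\- F) x @ within `[T0, T1] x^' --> - derive_in `[T0, T1] F x.
Proof.
move=> dF; have -> : diff_quot (\- F) x = \- diff_quot F x.
  by apply/funext => s; rewrite /diff_quot /= -mulNr; congr (_ / _); ring.
exact: cvgN.
Qed.

Lemma derive_inN (T0 T1 x : R) (F : R -> R) : T0 < T1 -> `[T0, T1]%classic x ->
  derivable_in `[T0, T1] F x ->
  derive_in `[T0, T1] (\- F) x = - derive_in `[T0, T1] F x.
Proof.
move=> T01 Tx dF; have pF := punctured_proper T01 Tx.
exact/cvg_lim/cvg_diff_quotN.
Qed.

Lemma C1_inN (T0 T1 : R) (F : R -> R) : T0 < T1 ->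
  C1_in `[T0, T1] F -> C1_in `[T0, T1] (\- F).
Proof.
move=> T01 [dF cF]; split.
  move=> x Tx; rewrite /derivable_in; apply/cvg_ex.
  by exists (- derive_in `[T0, T1] F x); exact/cvg_diff_quotN/dF.
move/subspace_continuousP : cF => cF; apply/subspace_continuousP => x Tx.
suff h : derive_in `[T0, T1] (\- F) @ within `[T0, T1] (nbhs x) -->
    - derive_in `[T0, T1] F x.
  by rewrite -(derive_inN T01 Tx (dF x Tx)) in h.
apply: cvg_trans (cvgN (cF x Tx)); apply: fmap_within_eq => s.
by rewrite inE => Ts; rewrite derive_inN//; exact: dF.
Qed.

Lemma hadamard_derN (T al t : R) (f : R -> R) : 1 < T -> 1 <= t <= T ->
  C1_in `[1, T] (hadamard_int (1 - al) f) ->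
  hadamard_der T al (\- f) t = - hadamard_der T al f t.
Proof.
move=> T1 tT [dF _]; rewrite /hadamard_der hadamard_intN derive_inN ?mulrN//.
by apply: dF; rewrite /= in_itv.
Qed.

End opposite.

Unset Implicit Arguments.
Set Strict Implicit.

Theorem proposition3p2 (R : realType) (T alpha : R) (f : R -> R)
    (hT : 1 < T) (halpha : 0 < alpha < 1)
    (hf : (@lebesgue_measure R).-integrable `[1, T] (EFin \o f))
    (hIf : C1_in `[1, T] (hadamard_int (1 - alpha) f)) :
  (forall t0 : R, 1 < t0 <= T ->
     f @ within `[1, T] (nbhs t0) --> f t0 ->
     (forall t, 1 <= t <= T -> f t <= f t0) ->
     hadamard_der T alpha f t0
       >= (Gamma (1 - alpha))^-1 * (ln t0) `^ (- alpha) * f t0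
     /\ (0 <= f t0 -> 0 <= hadamard_der T alpha f t0))
  /\
  (forall t0 : R, 1 < t0 <= T ->
     f @ within `[1, T] (nbhs t0) --> f t0 ->
     (forall t, 1 <= t <= T -> f t0 <= f t) ->
     hadamard_der T alpha f t0
       <= (Gamma (1 - alpha))^-1 * (ln t0) `^ (- alpha) * f t0
     /\ (f t0 <= 0 -> hadamard_der T alpha f t0 <= 0)).
Proof.
have k0 t : 0 <= (Gamma (1 - alpha))^-1 * ln t `^ (- alpha).
  by rewrite mulr_ge0 ?invr_ge0 ?Gamma_ge0 ?powR_ge0.
split=> t0 t0T cf fle.
  have H := hadamard_der_max_ge halpha t0T hf hIf cf fle.
  by split=> // f0; rewrite (le_trans _ H)// mulr_ge0.
have hfN : (@lebesgue_measure R).-integrable `[1, T] (EFin \o (\- f)).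
  exact: integrableN hf.
have hIfN : C1_in `[1, T] (hadamard_int (1 - alpha) (\- f)).
  by rewrite hadamard_intN; exact: C1_inN.
have H : hadamard_der T alpha f t0 <= (Gamma (1 - alpha))^-1 * ln t0 `^ (- alpha) * f t0.
  have /andP[t01 t0le] := t0T.
  rewrite -lerN2 -mulrN -hadamard_derN ?(ltW t01)//.
  apply: hadamard_der_max_ge => //; first exact: cvgN.
  by move=> t tT; rewrite lerN2 fle.
by split=> // f0; rewrite (le_trans H)// mulr_ge0_le0.
Qed.
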